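(* Let $E/\mathbb{Q}$ be an elliptic curve. Then the global generating function $B_{E/\mathbb{Q}}(s)$ has a simple pole at $s=2$ with $$\mathrm{Res}_{s=2}\big(B_{E/\mathbb{Q}}(s)\big)=\frac{\prod_{p\mid\Delta(E_p)}(1-\frac1p)(1-\frac1{p^3})^{-1}}{\prod'_{p\mid\Delta(E_p)}(1-\frac1{p^2})\cdot\prod''_{p\mid\Delta(E_p)}(1+\frac1{p^2})}\cdot\frac{L(E;2)}{\zeta(3)}.$$
   Context: For a prime $p$, $E_p$ denotes the reduction of $E$ modulo $p$; ''$p\nmid\Delta(E_p)$'' means that $E$ has good reduction at $p$ and ''$p\mid\Delta(E_p)$'' that it has bad reduction. For good $p$ write $\#E_p(\mathbb{F}_p)=1+p-t_p$. The symbol $\prod'_{p\mid\Delta(E_p)}$ denotes the product over primes of split multiplicative reduction and $\prod''_{p\mid\Delta(E_p)}$ the product over primes of non-split multiplicative reduction. The paper defines $$L(E;s)=\prod_{p\nmid\Delta(E_p)}\frac1{1-t_pp^{-s}+p^{1-2s}}\cdot\prod_{p\mid\Delta(E_p)}{}^{\prime}(1-p^{-s})\cdot\prod_{p\mid\Delta(E_p)}{}^{\prime\prime}(1+p^{-s}),$$ convergent for $\Re(s)>3/2$, and the global generating function $$B_{E/\mathbb{Q}}(s)=\prod_{p\nmid\Delta(E_p)}\frac{1}{1-t_pp^{-s}+p^{1-2s}}\cdot\frac{1-p^{1-2s}}{1-p^{1-s}}\qquad(\Re(s)>2),$$ which is continued meromorphically beyond $\Re(s)>2$. $\zeta$ is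 the Riemann zeta function. *)

(* Defs.v *)
From HB Require Import structures.
From mathcomp Require Import all_boot all_order all_algebra.
From mathcomp Require Import separable complex.
From mathcomp Require Import all_classical all_reals all_analysis.

Set Implicit Arguments.
Unset Strict Implicit.
Unset Printing Implicit Defensive.

Import Order.TTheory GRing.Theory Num.Theory.
Import numFieldNormedType.Exports.

Local Open Scope classical_set_scope.
Local Open Scope ring_scope.

(* y^2 + a1 x y + a3 y = x^3 + a2 x^2 + a4 x + a6 *)
Record weierstrass (F : Type) :=
  Weierstrass { wa1 : F; wa2 : F; wa3 : F; wa4 : F; wa6 : F }.

HB.instance Definition _ (F : Type) := gen_eqMixin (weierstrass F).
HB.instance Definition _ (F : Type) := gen_choiceMixin (weierstrass F).

Definition map_weierstrass (F G : Type) (f : F -> G) (W : weierstrass F) :=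
  Weierstrass (f (wa1 W)) (f (wa2 W)) (f (wa3 W)) (f (wa4 W)) (f (wa6 W)).

Section WeierstrassCurves.
Variable F : fieldType.
Implicit Type W : weierstrass F.

Definition wb2 W := wa1 W ^+ 2 + 4 * wa2 W.
Definition wb4 W := 2 * wa4 W + wa1 W * wa3 W.
Definition wb6 W := wa3 W ^+ 2 + 4 * wa6 W.
Definition wb8 W :=
  wa1 W ^+ 2 * wa6 W + 4 * wa2 W * wa6 W - wa1 W * wa3 W * wa4 W
  + wa2 W * wa3 W ^+ 2 - wa4 W ^+ 2.

Definition discriminant W :=
  - wb2 W ^+ 2 * wb8 W - 8 * wb4 W ^+ 3 - 27 * wb6 W ^+ 2
  + 9 * wb2 W * wb4 W * wb6 W.

Definition is_elliptic_curve W := discriminant W != 0.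

(* The curve in the coordinates (x', y') where x = u^2 x' + r and
   y = u^3 y' + u^2 s x' + t. *)
Definition change_variables (u r s t : F) W := Weierstrass
  ((wa1 W + 2 * s) / u)
  ((wa2 W - s * wa1 W + 3 * r - s ^+ 2) / u ^+ 2)
  ((wa3 W + r * wa1 W + 2 * t) / u ^+ 3)
  ((wa4 W - s * wa3 W + 2 * r * wa2 W - (t + r * s) * wa1 W
    + 3 * r ^+ 2 - 2 * s * t) / u ^+ 4)
  ((wa6 W + r * wa4 W + r ^+ 2 * wa2 W + r ^+ 3 - t * wa3 W - t ^+ 2
    - r * t * wa1 W) / u ^+ 6).

Definition isomorphic W W' :=
  exists u r s t : F, u != 0 /\ W' = change_variables u r s t W.

Definition weq W (x y : F) :=
  y ^+ 2 + wa1 W * x * y + wa3 W * y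
  - (x ^+ 3 + wa2 W * x ^+ 2 + wa4 W * x + wa6 W).

Definition singular_point W (x y : F) :=
  [&& weq W x y == 0,
      wa1 W * y - (3 * x ^+ 2 + 2 * wa2 W * x + wa4 W) == 0
    & 2 * y + wa1 W * x + wa3 W == 0].

(* The tangent cone at a singular point (x, y) is
   Y^2 + a1 X Y - (3 x + a2) X^2; the roots of this polynomial are the slopes
   of the tangent lines (none of which is vertical). *)
Definition tangent_slopes W (x : F) : {poly F} :=
  'X^2 + wa1 W *: 'X - (3 * x + wa2 W)%:P.

Definition node W (x y : F) :=
  singular_point W x y && separable_poly (tangent_slopes W x).

End WeierstrassCurves.

Section FinitePoints.
Variable F : finFieldType.
Implicit Type W : weierstrass F.

(* None is the point at infinity. *)
Definition points W : {set option (F * F)} :=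
  [set P | if P is Some (x, y) then weq W x y == 0 else true].

Definition is_split_multiplicative W :=
  [exists x, exists y, node W x y &&
    [exists m1, exists m2, tangent_slopes W x == ('X - m1%:P) * ('X - m2%:P)]].

Definition is_nonsplit_multiplicative W :=
  [exists x, exists y, node W x y &&
    ~~ [exists m1, exists m2,
          tangent_slopes W x == ('X - m1%:P) * ('X - m2%:P)]].

End FinitePoints.

Definition padic_val (p : nat) (x : rat) : int :=
  (logn p `|numq x|%N)%:Z - (logn p `|denq x|%N)%:Z.

Definition p_integral (p : nat) (x : rat) := ~~ (p %| `|denq x|)%N.

Definition integral_model (p : nat) (E W : weierstrass rat) :=
  isomorphic E W /\
  [&& p_integral p (wa1 W), p_integral p (wa2 W), p_integral p (wa3 W),
      p_integral p (wa4 W) & p_integral p (wa6 W)].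

Definition minimal_models (p : nat) (E : weierstrass rat) :
    set (weierstrass rat) :=
  [set W | integral_model p E W /\
    forall W', integral_model p E W' ->
      padic_val p (discriminant W) <= padic_val p (discriminant W')].

(* Minimal models at p exist and are unique up to p-integral changes of
   variables with u a p-unit, so nothing below depends on the choice made. *)
Definition minimal_model (p : nat) (E : weierstrass rat) : weierstrass rat :=
  xget E (minimal_models p E).

(* On p-integral rationals, ratr is the residue map to 'F_p. *)
Definition reduction (E : weierstrass rat) (p : nat) : weierstrass 'F_p :=
  map_weierstrass (fun x : rat => ratr x) (minimal_model p E).

Definition good (E : weierstrass rat) (p : nat) : bool :=
  discriminant (reduction E p) != 0.
Definition bad (E : weierstrass rat) (p : nat) : bool :=
  discriminant (reduction E p) == 0.
Definition split_mult (E : weierstrass rat) (p : nat) : bool :=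
  is_split_multiplicative (reduction E p).
Definition nonsplit_mult (E : weierstrass rat) (p : nat) : bool :=
  is_nonsplit_multiplicative (reduction E p).

Definition frob_trace (E : weierstrass rat) (p : nat) : int :=
  1 + p%:Z - #|points (reduction E p)|%:Z.

(* R[i], seen as a numeric field so that it carries the topology of its norm *)
Definition Cplx (R : realType) : numClosedFieldType := R[i].

Section ComplexFunctions.
Variable R : realType.
Local Notation C := (Cplx R).

Definition expC (z : C) : C :=
  Complex (expR (complex.Re z) * cos (complex.Im z))
          (expR (complex.Re z) * sin (complex.Im z)).

Definition natpowC (n : nat) (s : C) : C :=
  expC (s * Complex (ln (n%:R : R)) 0).

Definition zeta (s : C) : C :=
  lim ((fun N : nat => \sum_(1 <= n < N) natpowC n (- s)) @ \oo).

(* Primes are taken in increasing order. *)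
Definition prime_product (P : pred nat) (f : nat -> C) : C :=
  lim ((fun N : nat => \prod_(0 <= p < N | prime p && P p) f p) @ \oo).

Definition ell_L (E : weierstrass rat) (s : C) : C :=
  prime_product (good E) (fun p =>
    (1 - (frob_trace E p)%:~R * natpowC p (- s) + natpowC p (1 - 2 * s))^-1)
  * prime_product (split_mult E) (fun p => 1 - natpowC p (- s))
  * prime_product (nonsplit_mult E) (fun p => 1 + natpowC p (- s)).

Definition ell_B (E : weierstrass rat) (s : C) : C :=
  prime_product (good E) (fun p =>
    (1 - (frob_trace E p)%:~R * natpowC p (- s) + natpowC p (1 - 2 * s))^-1
    * ((1 - natpowC p (1 - 2 * s)) / (1 - natpowC p (1 - s)))).

Definition half_plane (c : R) : set C := [set s | c < complex.Re s].

Definition holomorphic_at (f : C -> C) (z : C) :=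
  \forall s \near z, derivable (f : C^o -> C^o) s 1.

Definition simple_pole (f : C -> C) (z r : C) :=
  r != 0 /\
  exists g : C -> C,
    [/\ holomorphic_at g z, g z = r &
        \forall s \near z, s != z -> f s = g s / (s - z)].

Definition meromorphic_at (f : C -> C) (z : C) :=
  exists (k : nat) (g : C -> C), holomorphic_at g z /\
    \forall s \near z, s != z -> f s = g s / (s - z) ^+ k.

Definition meromorphic_continuation (f : C -> C) (D U : set C) (F : C -> C) :=
  [/\ open U, connected U, D `<=` U,
      forall s, D s -> F s = f s &
      forall s, U s -> meromorphic_at F s].

End ComplexFunctions.

(* Main.v *)
Require Import Defs.
From mathcomp Require Import all_boot all_order all_algebra.
From mathcomp Require Import separable complex.
From mathcomp Require Import all_classical all_reals all_analysis.
From mathcomp Require Import ring lra zify.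
Import Order.TTheory GRing.Theory Num.Theory.
Import numFieldNormedType.Exports.
Set Implicit Arguments.
Unset Strict Implicit.
Unset Printing Implicit Defensive.
Local Open Scope ring_scope.

(** For [Re s > 2] the Euler factors of [B] can be regrouped as
    [B(s) = zeta(s - 1) * N(s) / D(s)], where
    [N(s)] is the product of [1 - p^(1-2s)] over the good primes times the
    product of [1 - p^(1-s)] over the bad ones, and
    [D(s)] is the product of [1 - t_p p^(-s) + p^(1-2s)] over the good primes.
    The continuation is this formula on the half-plane [Re s > 2 - 1/32]: there
    [(s - 2) zeta(s - 1)] extends holomorphically with value 1 at 2, and [N] and
    [D] are absolutely convergent products of nonzero factors, hence holomorphic
    and nonzero.  So the pole at 2 is simple with residue [N(2) / D(2)].  By the
    Euler product of [zeta(3)], [N(2)] is [1 / zeta(3)] times the product of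
    [(1 - p^-1) / (1 - p^-3)] over the bad primes; [1 / D(2)] is the good part of
    [L(E; 2)], and the multiplicative primes contribute the same nonzero finite
    products to [L(E; 2)] and to the denominator of the residue.

    Convergence of [D] left of 2 needs a power saving over [|t_p| <= p]; Hasse's
    bound is not required, and [t_p^4 <= 144 p^3] (lemma [frob_bound]) is proved
    by averaging.  Up to sign [t_p] is the sum over [x] of the quadratic character
    at a cubic polynomial [f(x)].  The fourth moment of this sum over all [p^4]
    polynomials of degree at most 3 is at most [3 p^6], because a point [x_i]
    distinct from the three others can be decoupled by interpolation
    ([cubic_fourth_moment]).  The sum for [f] is unchanged when [f(x)] becomes
    [e^2 f(u x + v)], and these [p (p-1)^2] substitutions reach each cubic at most
    12 times, so that a single sum cannot be large.  Almost all primes are good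
    ([bad_finite]): away from finitely many primes the given equation is
    itself integral with unit discriminant, hence minimal.

    Holomorphy is obtained without contour integrals.  The predicate [jet] bounds
    the value, the derivative and the quadratic Taylor error of a function at a
    point by one constant, which is subadditive for sums and submultiplicative for
    products, and a pointwise limit of functions with a common such bound is
    differentiable ([jet_lim_derivable]).  Thus sums and products of functions
    with summable [jet] bounds are differentiable, and for the functions
    [s |-> n^(b - a s)] such bounds come from the second order Taylor formula
    for the exponential ([cabs_expC_B1Dz]). *)


(** * Character sums over cubics and the bound for the trace of Frobenius *)

Section CharacterSums.
Variable F : finFieldType.
Local Notation q := (#|F|).

(** The quadratic character, as an integer: the number of square roots of [v]
    minus one. *)
Definition quad_char (v : F) : int := #|[set u : F | u ^+ 2 == v]|%:Z - 1.
Local Notation chi := quad_char.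

Lemma card_roots_le (p : {poly F}) (n : nat) :
  p != 0 -> (size p <= n.+1)%N -> (#|[set x | root p x]| <= n)%N.
Proof.
move=> p0 sp; rewrite cardE -ltnS; apply: leq_trans sp.
apply: max_poly_roots => //; last exact: enum_uniq.
by apply/allP => x; rewrite mem_enum inE.
Qed.

Lemma card_expf_eq (n : nat) (c : F) :
  (0 < n)%N -> (#|[set u : F | u ^+ n == c]| <= n)%N.
Proof.
move=> n0; have sp : size ('X^n - c%:P) = n.+1 by rewrite size_XnsubC.
have := @card_roots_le ('X^n - c%:P) n; rewrite -size_poly_eq0 sp leqnn => /(_ isT isT).
apply: leq_trans; apply: subset_leq_card; apply/fintype.subsetP => x.
by rewrite !inE rootE !hornerE subr_eq0.
Qed.

Lemma card_monic_quad_le (b c : F) :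
  (#|[set y : F | (y ^+ 2 + b * y + c == 0)%R]| <= 2)%N.
Proof.
have sp : size ('X^2 + (b *: 'X + c%:P)) = 3%N.
  rewrite size_polyDl size_polyXn // ltnS (leq_trans (size_polyD _ _)) //.
  rewrite geq_max (leq_trans (size_scale_leq _ _)) ?size_polyX //.
  by rewrite (leq_trans (size_polyC_leq1 _)).
have := @card_roots_le ('X^2 + (b *: 'X + c%:P)) 2.
rewrite -size_poly_eq0 sp => /(_ isT isT).
apply: leq_trans; apply: subset_leq_card; apply/fintype.subsetP => x.
by rewrite !inE rootE !hornerE ?addrA.
Qed.

Lemma quad_char_bound v : `|chi v| <= 1.
Proof.
have := @card_expf_eq 2 v isT; rewrite /chi.
by move: (#|_|) => [|[|[|k]]].
Qed.

Lemma quad_charM_sqr e v : e != 0 -> chi (e ^+ 2 * v) = chi v.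
Proof.
move=> e0; rewrite /chi; congr (_%:Z - 1).
rewrite -(card_imset [set u | u ^+ 2 == v] (mulfI e0)).
apply: eq_card => u; apply/idP/imsetP; rewrite !inE.
  move=> /eqP uv; exists (u / e); last by field.
  by rewrite inE expr_div_n uv; apply/eqP; field.
by move=> [w]; rewrite inE => /eqP <- ->; apply/eqP; ring.
Qed.

Lemma sum_quad_char : \sum_v chi v = 0.
Proof.
rewrite /chi sumrB -(big_morph Posz PoszD (erefl _)) sumr_const natz.
have -> : (\sum_(v : F) #|[set u : F | u ^+ 2 == v]|)%N = q.
  transitivity (\sum_(u : F) 1)%N; last by rewrite sum1_card.
  rewrite [RHS](partition_big (fun u : F => u ^+ 2) xpredT) //=.
  by apply: eq_bigr => v _; rewrite -sum1_card; apply: eq_bigl => u; rewrite inE.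
by rewrite subrr.
Qed.

Lemma sum_quad_char_line v c : c != 0 -> \sum_t chi (v + t * c) = 0.
Proof.
move=> c0; rewrite -[RHS]sum_quad_char.
have inj : injective (fun t => v + t * c).
  by move=> s t /addrI /(mulIf c0).
by rewrite [RHS](reindex_inj inj).
Qed.

(** The value at [x] of [c0 + c1 x + c2 x^2 + c3 x^3], a polynomial of degree at
    most 3 given by its quadruple of coefficients. *)
Definition cubic_eval (c : F * F * F * F) (x : F) : F :=
  c.1.1.1 + c.1.1.2 * x + c.1.2 * x ^+ 2 + c.2 * x ^+ 3.

(** The character sum attached to a polynomial of degree at most 3. *)
Definition cubic_sum (c : F * F * F * F) : int := \sum_x chi (cubic_eval c x).

Definition cubic_scale (t : F) (d : F * F * F * F) : F * F * F * F :=
  (t * d.1.1.1, t * d.1.1.2, t * d.1.2, t * d.2).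

Lemma cubic_evalD c d t x :
  cubic_eval (c + cubic_scale t d) x
  = cubic_eval c x + t * cubic_eval d x.
Proof. by move: c d => [[[a b] c] d] [[[a' b'] c'] d']; rewrite /cubic_eval /=; ring. Qed.

(** The contribution of a quadruple of points to the fourth moment. *)
Definition corr (x1 x2 x3 x4 : F) : int :=
  \sum_(c : F * F * F * F) chi (cubic_eval c x1) * chi (cubic_eval c x2) *
    chi (cubic_eval c x3) * chi (cubic_eval c x4).

(** Adding multiples of a cubic that vanishes at [x2], [x3] and [x4] but not at
    [x1] makes the value at [x1] equidistributed and keeps the three others. *)
Lemma corr_isolated x1 x2 x3 x4 :
  x1 != x2 -> x1 != x3 -> x1 != x4 -> corr x1 x2 x3 x4 = 0.
Proof.
move=> n2 n3 n4.
(* the coefficients of [(x - x2) (x - x3) (x - x4)] *)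
pose l : F * F * F * F := (- (x2 * x3 * x4), x2 * x3 + x2 * x4 + x3 * x4,
           - (x2 + x3 + x4), 1).
have lE x : cubic_eval l x = (x - x2) * (x - x3) * (x - x4).
  by rewrite /cubic_eval /=; ring.
suff: q%:Z * corr x1 x2 x3 x4 = 0.
  move/eqP; rewrite mulf_eq0 => /orP [|/eqP //].
  by rewrite eqz_nat -leqn0 leqNgt; case/negP; apply/card_gt0P; exists 0.
transitivity (\sum_(t : F) corr x1 x2 x3 x4).
  by rewrite sumr_const -[RHS]mulr_natl natz.
transitivity (\sum_(t : F) \sum_(c : F * F * F * F)
  chi (cubic_eval c x1 + t * cubic_eval l x1) * (chi (cubic_eval c x2) *
    chi (cubic_eval c x3) * chi (cubic_eval c x4))).
  apply: eq_bigr => t _; rewrite /corr.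
  rewrite (reindex_inj (addIr (cubic_scale t l))) /=.
  apply: eq_bigr => c _; rewrite !cubic_evalD !lE !subrr !(mulr0, mul0r, addr0).
  by rewrite !mulrA.
rewrite exchange_big big1 //= => c _; rewrite -mulr_suml sum_quad_char_line ?mul0r //.
by rewrite lE !mulf_neq0 // subr_eq0.
Qed.

Lemma corrC12 x1 x2 x3 x4 : corr x1 x2 x3 x4 = corr x2 x1 x3 x4.
Proof. by apply: eq_bigr => c _; ring. Qed.
Lemma corrC13 x1 x2 x3 x4 : corr x1 x2 x3 x4 = corr x3 x2 x1 x4.
Proof. by apply: eq_bigr => c _; ring. Qed.
Lemma corrC14 x1 x2 x3 x4 : corr x1 x2 x3 x4 = corr x4 x2 x3 x1.
Proof. by apply: eq_bigr => c _; ring. Qed.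

Lemma corr_le x1 x2 x3 x4 : corr x1 x2 x3 x4 <= q%:Z ^+ 4.
Proof.
rewrite (le_trans (ler_norm _)) // (le_trans (ler_norm_sum _ _ _)) //.
apply: (@le_trans _ _ (\sum_(c : F * F * F * F) 1)).
  apply: ler_sum => c _; rewrite !normrM.
  by rewrite !mulr_ile1 ?mulr_ge0 ?quad_char_bound.
by rewrite sumr_const !card_prod !natrM !natz !exprS expr0 mulr1 !mulrA.
Qed.

(** Only quadruples that split into two pairs of equal points contribute: when
    all four points are not so paired, one of them differs from the others. *)
Lemma corr_le_pairs x1 x2 x3 x4 : corr x1 x2 x3 x4 <=
  q%:Z ^+ 4 * ((x1 == x2)%:R * (x3 == x4)%:R + (x1 == x3)%:R * (x2 == x4)%:R
               + (x1 == x4)%:R * (x2 == x3)%:R).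
Proof.
have q0 : 0 <= q%:Z ^+ 4 by rewrite exprn_ge0.
have H (k : int) : 1 <= k -> corr x1 x2 x3 x4 <= q%:Z ^+ 4 * k.
  by move=> k1; rewrite (le_trans (corr_le _ _ _ _)) // ler_peMr.
have H0 (k : int) : corr x1 x2 x3 x4 = 0 -> 0 <= k -> corr x1 x2 x3 x4 <= q%:Z ^+ 4 * k.
  by move=> -> k0; rewrite mulr_ge0.
case: (eqVneq x3 x4) => [e34|n34]; case: (eqVneq x1 x2) => [e12|n12];
  case: (eqVneq x1 x3) => [e13|n13]; case: (eqVneq x2 x4) => [e24|n24];
  case: (eqVneq x1 x4) => [e14|n14]; case: (eqVneq x2 x3) => [e23|n23];
  (try by apply: H); apply: H0 => //;
  by [ apply: corr_isolated
     | rewrite corrC12; apply: corr_isolated => //; rewrite eq_sym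
     | rewrite corrC13; apply: corr_isolated => //; rewrite eq_sym
     | rewrite corrC14; apply: corr_isolated => //; rewrite eq_sym
     | subst; match goal with n : is_true (?x != ?x) |- _ => rewrite eqxx in n end].
Qed.

Lemma sum_eq_indicator (x : F) : \sum_y (x == y)%:R = 1 :> int.
Proof.
by rewrite (bigD1 x) //= eqxx big1 ?addr0 // => y; rewrite eq_sym => /negbTE ->.
Qed.

(** Mean value of the fourth power over the [q^4] polynomials: the count of
    paired quadruples is at most [3 q^2], each contributing at most [q^4]. *)
Lemma cubic_fourth_moment : \sum_(c : F * F * F * F) cubic_sum c ^+ 4 <= 3 * q%:Z ^+ 6.
Proof.
have -> : \sum_(c : F * F * F * F) cubic_sum c ^+ 4 =
    \sum_x1 \sum_x2 \sum_x3 \sum_x4 corr x1 x2 x3 x4.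
  have -> : \sum_(c : F * F * F * F) cubic_sum c ^+ 4 = \sum_c \sum_x1 \sum_x2 \sum_x3 \sum_x4
     chi (cubic_eval c x1) * chi (cubic_eval c x2) *
    chi (cubic_eval c x3) * chi (cubic_eval c x4).
    apply: eq_bigr => c _; rewrite !exprS expr0 mulr1 {1}/cubic_sum mulr_suml.
    apply: eq_bigr => x1 _; rewrite mulrA {1}/cubic_sum [X in X * _]mulr_sumr mulr_suml.
    apply: eq_bigr => x2 _; rewrite mulrA {1}/cubic_sum [X in X * _]mulr_sumr mulr_suml.
    apply: eq_bigr => x3 _; rewrite {1}/cubic_sum mulr_sumr.
    by apply: eq_bigr => x4 _.
  rewrite exchange_big; apply: eq_bigr => x1 _.
  rewrite exchange_big; apply: eq_bigr => x2 _.
  rewrite exchange_big; apply: eq_bigr => x3 _.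
  by rewrite exchange_big; apply: eq_bigr => x4 _.
apply: (@le_trans _ _ (\sum_x1 \sum_x2 \sum_x3 \sum_x4
  q%:Z ^+ 4 * ((x1 == x2)%:R * (x3 == x4)%:R + (x1 == x3)%:R * (x2 == x4)%:R
               + (x1 == x4)%:R * (x2 == x3)%:R))).
  do 4 (apply: ler_sum => ? _).
  exact: corr_le_pairs.
have cst : \sum_(x : F) 1 = q%:Z :> int by rewrite sumr_const natz.
rewrite le_eqVlt; apply/orP; left; apply/eqP.
transitivity (\sum_(x1 : F) \sum_(x2 : F) q%:Z ^+ 4 * ((x1 == x2)%:R * q%:Z + 2)).
  apply: eq_bigr => x1 _; apply: eq_bigr => x2 _.
  transitivity (\sum_(x3 : F) q%:Z ^+ 4 * ((x1 == x2)%:R + (x1 == x3)%:R + (x2 == x3)%:R)).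
    apply: eq_bigr => x3 _; rewrite -mulr_sumr; congr (_ * _).
    by rewrite !big_split /= -!mulr_sumr -mulr_suml !sum_eq_indicator !mulr1 mul1r.
  rewrite -mulr_sumr; congr (_ * _).
  rewrite !big_split /= !sum_eq_indicator.
  have -> : \sum_(i : F) (x1 == x2)%:R = (x1 == x2)%:R * q%:Z :> int.
    by rewrite sumr_const -[LHS]mulr_natr (natz #|_|).
  by move: (_ * q%:Z) => z; ring.
transitivity (\sum_(x1 : F) q%:Z ^+ 4 * (3 * q%:Z)).
  apply: eq_bigr => x1 _; rewrite -mulr_sumr; congr (_ * _).
  rewrite big_split /= -mulr_suml sum_eq_indicator sumr_const.
  by rewrite -[2 *+ _]mulr_natl natz; ring.
by rewrite sumr_const -[LHS]mulr_natl natz; ring.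
Qed.

(** The coefficients of [e^2 A (Y^3 + a Y + b)] at [Y = u x + v]. *)
Definition depressed_orbit (A a b : F) (g : F * F * F) : F * F * F * F :=
  let: (e, u, v) := g in
  (e ^+ 2 * A * (v ^+ 3 + a * v + b), e ^+ 2 * A * u * (3 * v ^+ 2 + a),
   3 * e ^+ 2 * A * u ^+ 2 * v, e ^+ 2 * A * u ^+ 3).

Lemma cubic_eval_orbit A a b e u v x :
  cubic_eval (depressed_orbit A a b (e, u, v)) x =
  e ^+ 2 * cubic_eval (A * b, A * a, 0, A) (u * x + v).
Proof. by rewrite /cubic_eval /=; ring. Qed.

Lemma cubic_sum_affine c e u v d : e != 0 -> u != 0 ->
  (forall x, cubic_eval d x = e ^+ 2 * cubic_eval c (u * x + v)) ->
  cubic_sum d = cubic_sum c.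
Proof.
move=> e0 u0 H; rewrite /cubic_sum.
have inj : injective (fun x => u * x + v) by move=> x y /addIr /(mulfI u0).
rewrite [RHS](reindex_inj inj); apply: eq_bigr => x _.
by rewrite H quad_charM_sqr.
Qed.

(** A substitution is determined by [w = e u]: two substitutions with the same
    image agree on [e^2 u^3] and [v / u], and also on [u^2] or on [u^3], according
    to whether [a] or only [b] is nonzero; hence on [u^6], and [w] satisfies an
    equation [w^12 = k]. *)
Lemma depressed_orbit_fiber (A a b : F) c : 3 != 0 :> F -> A != 0 ->
  (a != 0) || (b != 0) ->
  (#|[set g : F * F * F | [&& g.1.1 != 0, g.1.2 != 0 & depressed_orbit A a b g == c]%R]|
    <= 12)%N.
Proof.
move=> t0 A0 ab; set Sg := [set g | _].
have [->|[g0 g0S]] := set_0Vmem Sg; first by rewrite cards0.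
case: g0 g0S => [[e0 u0] v0]; rewrite !inE /= => /and3P[e0n u0n /eqP gc].
pose k := ((e0 ^+ 2 * u0 ^+ 3) ^+ 6 / u0 ^+ 6).
have key e u v : (e, u, v) \in Sg ->
   [/\ e != 0, u != 0, e ^+ 2 * u ^+ 3 = e0 ^+ 2 * u0 ^+ 3,
       v / u = v0 / u0 & u ^+ 6 = u0 ^+ 6].
  rewrite !inE /= => /and3P[en un /eqP]; rewrite -gc => -[E0 E1 E2 E3].
  have h3 : e ^+ 2 * u ^+ 3 = e0 ^+ 2 * u0 ^+ 3.
    apply: (mulfI A0); transitivity (e ^+ 2 * A * u ^+ 3); first by ring.
    by rewrite E3; ring.
  have m0 : 3 * A * (e ^+ 2 * u ^+ 3) != 0 by rewrite !mulf_neq0 // expf_neq0.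
  have hv : v / u = v0 / u0.
    apply: (mulfI m0); rewrite {2}h3.
    transitivity (3 * e ^+ 2 * A * u ^+ 2 * v); first by field.
    by rewrite E2; field.
  have vE : v = v0 / u0 * u by rewrite -hv; field.
  split=> //.
  have m1 : A * (e ^+ 2 * u ^+ 3) != 0 by rewrite !mulf_neq0 // expf_neq0.
  have ha : a / u ^+ 2 = a / u0 ^+ 2.
    apply: (addrI (3 * (v / u) ^+ 2)); apply: (mulfI m1); rewrite {2}h3 {2}hv.
    transitivity (e ^+ 2 * A * u * (3 * v ^+ 2 + a)); first by field.
    by rewrite E1; field.
  case: (eqVneq a 0) ab => [az /= b0|a0 _].
    have /(mulfI b0) /invr_inj h : b / u ^+ 3 = b / u0 ^+ 3.
      apply: (addrI ((v / u) ^+ 3)); apply: (mulfI m1); rewrite {2}h3 {2}hv.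
      transitivity (e ^+ 2 * A * (v ^+ 3 + a * v + b)); first by rewrite az; field.
      by rewrite E0 az; field.
    by rewrite -[6%N]/(3 * 2)%N !exprM h.
  by move/(mulfI a0)/invr_inj: ha => h; rewrite -[6%N]/(2 * 3)%N !exprM h.
pose w (g : F * F * F) := g.1.1 * g.1.2.
have winj : {in Sg &, injective w}.
  move=> [[e u] v] [[e' u'] v'] /key [en un h3 hv h6] /key [en' un' h3' hv' h6'].
  rewrite /w /= => ww.
  have uu : u = u'.
    have m : (e * u) ^+ 2 != 0 by rewrite expf_neq0 // mulf_neq0.
    apply: (mulfI m); rewrite {2}ww.
    transitivity (e ^+ 2 * u ^+ 3); first by ring.
    by rewrite h3 -h3'; ring.
  have ee : e = e' by apply: (mulIf un); rewrite ww uu.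
  by rewrite ee uu; congr (_, _); rewrite -[v](divfK un) hv -hv' uu divfK.
rewrite -(card_in_imset winj); apply: leq_trans (@card_expf_eq 12 k isT).
apply: subset_leq_card; apply/fintype.subsetP => y /imsetP [[[e u] v] /key [en un h3 hv h6] ->].
rewrite inE /w /k /= -h3 -h6; apply/eqP; by field.
Qed.

Lemma card_finField_gt1 : (1 < q)%N.
Proof. by rewrite -cardsT; apply: (@leq_trans #|[set 0; 1 : F]|); [rewrite cards2 eq_sym oner_eq0 | apply: subset_leq_card; apply/fintype.subsetP]. Qed.

Lemma depressed_cubic_sum_bound (A a b : F) : 3 != 0 :> F -> A != 0 ->
  (a != 0) || (b != 0) ->
  cubic_sum (A * b, A * a, 0, A) ^+ 4 <= 144 * q%:Z ^+ 3.
Proof.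
move=> t0 A0 ab; set S := cubic_sum _.
pose G := [pred g : F * F * F | (g.1.1 != 0) && (g.1.2 != 0)].
have SG g : G g -> cubic_sum (depressed_orbit A a b g) = S.
  case: g => [[e u] v] /andP[/= e0 u0].
  by apply: (cubic_sum_affine e0 u0 (cubic_eval_orbit A a b e u v)).
have cardG : (\sum_(g | G g) 1 = (q.-1) ^ 2 * q)%N.
  rewrite sum1dep_card.
  have -> : [set g | G g] = finset.setX (finset.setX [set~ 0] [set~ 0]) [set: F].
    by apply/finset.setP => -[[e u] v]; rewrite !inE /= andbT.
  by rewrite !cardsX cardsT !cardsC1 mulnn.
have s1 : \sum_(g | G g) cubic_sum (depressed_orbit A a b g) ^+ 4
   = ((q.-1) ^ 2 * q)%N%:Z * S ^+ 4.
  rewrite (eq_bigr (fun=> S ^+ 4)) => [|g Gg]; last by rewrite SG.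
  by rewrite sumr_const -sum1_card cardG -[LHS]mulr_natl natz.
have s2 : \sum_(g | G g) cubic_sum (depressed_orbit A a b g) ^+ 4 <= 36 * q%:Z ^+ 6.
  rewrite (partition_big (depressed_orbit A a b) xpredT) //=.
  apply: (@le_trans _ _ (\sum_(c : F * F * F * F) 12 * cubic_sum c ^+ 4)).
    apply: ler_sum => c _.
    rewrite (eq_bigr (fun=> cubic_sum c ^+ 4)) => [|g /andP[_ /eqP ->]//].
    rewrite sumr_const -[X in X <= _]mulr_natl ler_wpM2r //.
      by rewrite -[4%N]/(2 * 2)%N exprM sqr_ge0.
    rewrite natz -[12]/(12%:Z) lez_nat.
    apply: leq_trans (depressed_orbit_fiber c t0 A0 ab).
    by apply: subset_leq_card; apply/fintype.subsetP => g; rewrite inE unfold_in andbA.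
  rewrite -mulr_sumr (le_trans (ler_wpM2l _ cubic_fourth_moment)) //.
  by rewrite mulrA.
move: s2; rewrite s1.
have q1 := card_finField_gt1.
have S0 : 0 <= S ^+ 4 by rewrite -[4%N]/(2 * 2)%N exprM sqr_ge0.
move: (S ^+ 4) S0 => T T0 H.
have h4 : (q ^ 2 <= 4 * (q.-1) ^ 2)%N by nia.
have q0 : 0 < q%:Z ^+ 3 by rewrite exprn_gt0 // ltz_nat; lia.
rewrite -(ler_pM2r q0).
have h5 : (q ^ 3 <= 4 * ((q.-1) ^ 2 * q))%N by rewrite expnS mulnC mulnA leq_mul2r h4 orbT.
have h6 : q%:Z ^+ 3 <= 4 * ((q.-1) ^ 2 * q)%N%:Z by rewrite -[_ ^+ 3]/((q ^ 3)%N%:Z); lia.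
have h7 := ler_wpM2l T0 h6.
have -> : 144 * q%:Z ^+ 3 * q%:Z ^+ 3 = 4 * (36 * q%:Z ^+ 6) by ring.
lia.
Qed.

Implicit Type W : weierstrass F.

Lemma card_points W : #|points W|%:Z =
  1 + \sum_x #|[set y | (weq W x y == 0)%R]|%:Z.
Proof.
have -> : points W = None |: (Some @: [set P : F * F | weq W P.1 P.2 == 0]).
  apply/finset.setP => -[[x y]|]; rewrite !inE //=; apply/idP/imsetP.
    by move=> h; exists (x, y); rewrite ?inE.
  by move=> [[x' y']]; rewrite inE /= => h [-> ->].
rewrite cardsU1 (_ : None \in _ = false) /=; last first.
  by apply/negbTE/negP => /imsetP [].
rewrite PoszD card_imset; last exact: Some_inj.
congr (_ + _); rewrite -(big_morph Posz PoszD (erefl _)); congr (_%:Z).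
rewrite -sum1_card (eq_bigl (fun P : F * F => (weq W P.1 P.2 == 0))); last first.
  by move=> P; rewrite inE.
rewrite -(pair_big_dep xpredT (fun x y => weq W x y == 0) (fun _ _ => 1%N)) /=.
by apply: eq_bigr => x _; rewrite -sum1_card; apply: eq_bigl => y; rewrite inE.
Qed.

(** There are at most two points over each [x]. *)
Lemma frob_trivial_bound W : `|1 + q%:Z - #|points W|%:Z| <= q%:Z.
Proof.
rewrite card_points.
have : 0 <= \sum_x #|[set y | (weq W x y == 0)%R]|%:Z <= 2 * q%:Z.
  rewrite sumr_ge0 //=; apply: (@le_trans _ _ (\sum_(x : F) 2)).
    apply: ler_sum => x _.
    have := card_monic_quad_le (wa1 W * x + wa3 W)
       (- (x ^+ 3 + wa2 W * x ^+ 2 + wa4 W * x + wa6 W)).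
    rewrite (_ : [set y | _] = [set y | weq W x y == 0]) ?lez_nat //.
    by apply/finset.setP => y; rewrite !inE /weq; congr (_ == 0); ring.
  by rewrite sumr_const -[X in X <= _]mulr_natr (natz #|_|).
lia.
Qed.

(** Completing the square, [y] is a point over [x] if and only if
    [2 y + a1 x + a3] is a square root of [4 x^3 + b2 x^2 + 2 b4 x + b6]. *)
Lemma frob_quad_char W : 2 != 0 :> F ->
  1 + q%:Z - #|points W|%:Z =
  - cubic_sum (wb6 W, 2 * wb4 W, wb2 W, 4).
Proof.
move=> t0; rewrite card_points /cubic_sum.
rewrite (eq_bigr (fun x => chi (cubic_eval (wb6 W, 2 * wb4 W, wb2 W, 4) x) + 1)).
  by rewrite big_split /= sumr_const natz; ring.
move=> x _; rewrite /chi subrK; congr (_%:Z).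
have inj : injective (fun y => 2 * y + (wa1 W * x + wa3 W)).
  by move=> y y' /addIr /(mulfI t0).
rewrite -(card_imset [set y | weq W x y == 0] inj).
have H y : (2 * y + (wa1 W * x + wa3 W)) ^+ 2 - cubic_eval (wb6 W, 2 * wb4 W, wb2 W, 4) x = 2 ^+ 2 * weq W x y.
  by rewrite /cubic_eval /weq /wb2 /wb4 /wb6 /=; ring.
apply: eq_card => u; apply/imsetP/idP; rewrite !inE.
  by move=> [y]; rewrite inE => /eqP h ->; rewrite -subr_eq0 H h mulr0.
move=> /eqP h; exists ((u - (wa1 W * x + wa3 W)) / 2); last by field.
rewrite inE; apply/eqP; apply: (mulfI (expf_neq0 2 t0)); rewrite -H mulr0.
by rewrite mulrC divfK // subrK h subrr.
Qed.

(** The discriminant is [-16 (4 a^3 + 27 b^2)] in terms of the depressed cubic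
    [4 (Y^3 + a Y + b)], so [a] and [b] are not both zero. *)
Lemma frob_bound W : 2 != 0 :> F -> 3 != 0 :> F -> discriminant W != 0 ->
  (1 + q%:Z - #|points W|%:Z) ^+ 4 <= 144 * q%:Z ^+ 3.
Proof.
move=> t0 th0 dW; rewrite frob_quad_char // -[4%N]/(2 * 2)%N exprM sqrrN -exprM /=.
have f0 : 4 != 0 :> F by rewrite (_ : 4 = 2 * 2) ?mulf_neq0 //; ring.
have tw0 : 12 != 0 :> F by rewrite (_ : 12 = 4 * 3) ?mulf_neq0 //; ring.
(* [x = Y - k] removes the quadratic term *)
pose k := wb2 W / 12.
pose a := wb4 W / 2 - 3 * k ^+ 2.
pose b := wb6 W / 4 - k * wb4 W / 2 + 2 * k ^+ 3.
have ab : (a != 0) || (b != 0).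
  rewrite -negb_and; apply: contra dW => /andP[/eqP az /eqP bz].
  have -> : discriminant W = - 16 * (4 * a ^+ 3 + 27 * b ^+ 2).
    by rewrite /a /b /k /discriminant /wb8 /wb6 /wb4 /wb2; field; rewrite ?f0 ?t0 ?tw0.
  by rewrite az bz !expr0n /= !mulr0 addr0 mulr0.
have := depressed_cubic_sum_bound th0 f0 ab.
rewrite -(@cubic_sum_affine (4 * b, 4 * a, 0, 4) 1 1 k
   (wb6 W, 2 * wb4 W, wb2 W, 4)) ?oner_eq0 // => x.
by rewrite /cubic_eval /= /a /b /k; field; rewrite ?f0 ?t0 ?tw0.
Qed.

End CharacterSums.

(** * Reduction of rational curves modulo primes *)

Section Reduction.
Variables (p : nat) (p_pr : prime p).

Lemma intr_Fp_eq0 (m : int) : ((m%:~R : 'F_p) == 0) = (p %| `|m|)%N.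
Proof.
rewrite (dvdn_pcharf (pchar_Fp p_pr)); case: m => n //=.
by rewrite NegzE mulrNz oppr_eq0.
Qed.

(** [y] is the residue mod [p] of the [p]-integral rational [x]. *)
Definition residue (x : rat) (y : 'F_p) : Prop := exists a b : int,
  [/\ (b%:~R : 'F_p) != 0, x * b%:~R = a%:~R & y = a%:~R / b%:~R].

Lemma p_integral_residue x : p_integral p x -> residue x (ratr x).
Proof.
move=> ix; exists (numq x), (denq x); split=> //; last by rewrite numqE.
by rewrite intr_Fp_eq0.
Qed.

Lemma residue_p_integral x y : residue x y -> p_integral p x /\ ratr x = y.
Proof.
move=> [a [b [b0 xb ->]]].
have nb : numq x * b = a * denq x.
  by apply: (@intr_inj rat); rewrite !intrM numqE -xb; ring.
have d0 : ((denq x)%:~R : 'F_p) != 0.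
  have db : (denq x %| b)%Z.
    by rewrite -(@Gauss_dvdzr _ (numq x)) ?nb ?dvdz_mull // coprimez_sym; apply: coprime_num_den.
  by apply: contra b0; rewrite !intr_Fp_eq0 => /dvdn_trans; apply.
split; first by rewrite /p_integral -intr_Fp_eq0.
have : ((numq x)%:~R * b%:~R : 'F_p) = a%:~R * (denq x)%:~R by rewrite -!intrM nb.
rewrite /ratr => h; apply: (mulIf d0); rewrite divfK //.
by apply: (mulIf b0); rewrite h; field.
Qed.

Lemma residueD x x' y y' : residue x y -> residue x' y' -> residue (x + x') (y + y').
Proof.
move=> [a [b [b0 xb ->]]] [a' [b' [b0' xb' ->]]].
exists (a * b' + a' * b), (b * b'); split.
- by rewrite intrM mulf_neq0.
- by rewrite intrD !intrM -xb -xb'; ring.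
- by rewrite intrD !intrM; field; rewrite b0 b0'.
Qed.

Lemma residueM x x' y y' : residue x y -> residue x' y' -> residue (x * x') (y * y').
Proof.
move=> [a [b [b0 xb ->]]] [a' [b' [b0' xb' ->]]].
exists (a * a'), (b * b'); split.
- by rewrite intrM mulf_neq0.
- by rewrite !intrM -xb -xb'; ring.
- by rewrite !intrM; field; rewrite b0 b0'.
Qed.

Lemma residueN x y : residue x y -> residue (- x) (- y).
Proof.
move=> [a [b [b0 xb ->]]]; exists (- a), b; split=> //.
- by rewrite mulNr xb intrN.
- by rewrite intrN mulNr.
Qed.

Lemma residue_nat n : residue n%:R n%:R.
Proof. by exists n%:Z, 1; rewrite !mulr1 divr1 oner_eq0. Qed.

Lemma residueX n x y : residue x y -> residue (x ^+ n) (y ^+ n).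
Proof.
move=> h; elim: n => [|n ih]; first exact: (residue_nat 1).
by rewrite !exprS; apply: residueM.
Qed.

(** All coefficients are [p]-integral. *)
Definition integral_coefs (W : weierstrass rat) :=
  [&& p_integral p (wa1 W), p_integral p (wa2 W), p_integral p (wa3 W),
      p_integral p (wa4 W) & p_integral p (wa6 W)].

Lemma residue_discriminant W : integral_coefs W ->
  residue (discriminant W)
    (discriminant (map_weierstrass (fun x : rat => ratr x : 'F_p) W)).
Proof.
case: W => a1 a2 a3 a4 a6 /and5P[]; rewrite /= => i1 i2 i3 i4 i6.
have [h1 h2 h3] := And3 (p_integral_residue i1) (p_integral_residue i2) (p_integral_residue i3).
have [h4 h6] := conj (p_integral_residue i4) (p_integral_residue i6).
pose n := residue_nat.
have b2 := residueD (residueX 2 h1) (residueM (n 4) h2).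
have b4 := residueD (residueM (n 2) h4) (residueM h1 h3).
have b6 := residueD (residueX 2 h3) (residueM (n 4) h6).
have b8 := residueD (residueD (residueD (residueD (residueM (residueX 2 h1) h6)
  (residueM (residueM (n 4) h2) h6)) (residueN (residueM (residueM h1 h3) h4)))
  (residueM h2 (residueX 2 h3))) (residueN (residueX 2 h4)).
exact: (residueD (residueD (residueD (residueM (residueN (residueX 2 b2)) b8)
  (residueN (residueM (n 8) (residueX 3 b4)))) (residueN (residueM (n 27) (residueX 2 b6))))
  (residueM (residueM (residueM (n 9) b2) b4) b6)).
Qed.

Lemma residue_neq0 x y : residue x y -> ~~ (p %| `|numq x|)%N -> y != 0.
Proof.
move=> /residue_p_integral [ix <-]; rewrite -intr_Fp_eq0 => n0.
by rewrite /ratr mulf_neq0 // invr_neq0 // intr_Fp_eq0.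
Qed.

End Reduction.

Lemma discriminant_change (F : fieldType) (u r s t : F) W : u != 0 ->
  discriminant (change_variables u r s t W) * u ^+ 12 = discriminant W.
Proof.
move=> u0; rewrite /discriminant /wb8 /wb6 /wb4 /wb2 /=.
by field.
Qed.

Lemma change_variables_id (F : fieldType) (W : weierstrass F) :
  change_variables 1 0 0 0 W = W.
Proof.
by case: W => a1 a2 a3 a4 a6; rewrite /change_variables /=; rewrite !expr1n !divr1; congr Weierstrass; ring.
Qed.

(** A curve has good reduction outside the primes dividing the denominators of
    its coefficients or its discriminant. *)
Lemma bad_finite (E : weierstrass rat) : is_elliptic_curve E ->
  exists N, forall p, prime p -> (N <= p)%N -> ~~ bad E p.
Proof.
move=> dE.
(* a prime larger than [M] divides none of these nonzero integers *)
pose M := (`|denq (wa1 E)| + `|denq (wa2 E)| + `|denq (wa3 E)| + `|denq (wa4 E)|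
  + `|denq (wa6 E)| + `|numq (discriminant E)|)%N.
exists M.+1 => p p_pr pM.
have ndvd m : (0 < m <= M)%N -> ~~ (p %| m)%N.
  by move=> /andP[m0 mM]; rewrite gtnNdvd //; lia.
have d0 x : (0 < `|denq x|)%N by rewrite absz_gt0 denq_neq0.
have iE : integral_coefs p E.
  by apply/and5P; split; apply: ndvd; rewrite d0 /= /M; lia.
have ndisc : ~~ (p %| `|numq (discriminant E)|)%N.
  by apply: ndvd; rewrite absz_gt0 numq_eq0 [_ != 0]dE /M /=; lia.
have mE : integral_model p E E.
  split=> //; exists 1, 0, 0, 0; split; first exact: oner_neq0.
  by rewrite change_variables_id.
have val_integral x : p_integral p x -> padic_val p x = logn p `|numq x|.
  move=> ix; rewrite /padic_val [X in _ - X%:Z](_ : _ = 0%N) ?subr0 //.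
  by apply/eqP; rewrite lognE (negbTE ix) !andbF.
have int_disc W : integral_coefs p W -> p_integral p (discriminant W).
  by move=> /(residue_discriminant p_pr) /(residue_p_integral p_pr) [].
have valE : padic_val p (discriminant E) = 0.
  by rewrite val_integral ?int_disc // lognE (negbTE ndisc) !andbF.
have minE : minimal_models p E E.
  split=> // W [_ iW]; rewrite valE val_integral //; exact: int_disc.
have [[isoW iW] Wmin] : minimal_models p E (minimal_model p E).
  exact: (xgetI _ minE).
rewrite /bad /reduction.
apply: (residue_neq0 p_pr (residue_discriminant p_pr iW)).
have := Wmin _ mE; rewrite valE val_integral ?int_disc // lez_nat leqn0.
rewrite lognE p_pr /= absz_gt0 numq_eq0.
case: isoW => u [r [s [t [u0 WE]]]].
have -> : discriminant (minimal_model p E) != 0.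
  by apply: contra dE => /eqP h; rewrite -(discriminant_change r s t E u0) -WE h mul0r.
by rewrite /=; case: (p %| _)%N.
Qed.

Section FrobeniusTrace.
Variables (E : weierstrass rat) (p : nat).
Hypothesis p_pr : prime p.

Lemma frob_trace_le : `|frob_trace E p| <= p%:Z.
Proof. by have := frob_trivial_bound (reduction E p); rewrite card_Fp. Qed.

Lemma frob_trace_bound : (3 < p)%N -> good E p ->
  frob_trace E p ^+ 4 <= 144 * p%:Z ^+ 3.
Proof.
move=> p3; rewrite /good => gp.
have n0 k : (0 < k < p)%N -> k%:R != 0 :> 'F_p.
  move=> /andP[k0 kp]; rewrite -(dvdn_pcharf (pchar_Fp p_pr)).
  by rewrite gtnNdvd.
have := @frob_bound _ (reduction E p); rewrite card_Fp //; apply=> //; apply: n0 => //.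
by lia.
Qed.

End FrobeniusTrace.

Local Open Scope classical_set_scope.

(** * The complex modulus *)

Section ComplexModulus.
Variable R : realType.
Local Notation C := (Cplx R).
Local Notation Re := (@complex.Re R).
Local Notation Im := (@complex.Im R).

(** The modulus as an element of [R], where inequalities are total. *)
Definition cabs (z : C) : R := Normc.normc z.

Lemma cabsE (z : C) : `|z| = (cabs z)%:C%C.
Proof. by []. Qed.

Lemma cabs_ge0 z : 0 <= cabs z.
Proof. by case: z => a b; rewrite /cabs /= sqrtr_ge0. Qed.

Lemma cabs0 : cabs 0 = 0. Proof. exact: Normc.normc0. Qed.
Lemma cabs1 : cabs 1 = 1. Proof. exact: Normc.normc1. Qed.

Lemma cabs0_eq z : cabs z = 0 -> z = 0.
Proof. exact: Normc.eq0_normc. Qed.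

Lemma cabs_gt0 z : z != 0 -> 0 < cabs z.
Proof.
by move=> z0; rewrite lt_neqAle cabs_ge0 andbT eq_sym; apply: contra z0 => /eqP/cabs0_eq ->.
Qed.

Lemma cabsM x y : cabs (x * y) = cabs x * cabs y.
Proof. exact: Normc.normcM. Qed.

Lemma cabsV x : cabs x^-1 = (cabs x)^-1.
Proof. exact: Normc.normcV. Qed.

Lemma cabsX x n : cabs (x ^+ n) = cabs x ^+ n.
Proof. by elim: n => [|n ih]; rewrite ?cabs1 // !exprS cabsM ih. Qed.

Lemma cabsD x y : cabs (x + y) <= cabs x + cabs y.
Proof. exact: le_normcD. Qed.

Lemma cabsN x : cabs (- x) = cabs x.
Proof. exact: normcN. Qed.

Lemma cabsB x y : cabs (x - y) <= cabs x + cabs y.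
Proof. by rewrite -(cabsN y); exact: cabsD. Qed.

Lemma cabs_distC x y : cabs (x - y) = cabs (y - x).
Proof. by rewrite -opprB cabsN. Qed.

Lemma cabsB_ge x y : cabs x - cabs y <= cabs (x + y).
Proof. by have := cabsB (x + y) y; rewrite addrK => h; rewrite lerBlDr. Qed.

Lemma cabs_sum I (s : seq I) (P : pred I) (f : I -> C) :
  cabs (\sum_(i <- s | P i) f i) <= \sum_(i <- s | P i) cabs (f i).
Proof.
elim/big_rec2: _ => [|i y x _ h]; first by rewrite cabs0.
by rewrite (le_trans (cabsD _ _)) // lerD2l.
Qed.

Lemma cabs_prod I (s : seq I) (P : pred I) (f : I -> C) :
  cabs (\prod_(i <- s | P i) f i) = \prod_(i <- s | P i) cabs (f i).
Proof. by elim/big_rec2: _ => [|i y x _ h]; rewrite ?cabs1 // cabsM h. Qed.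

Lemma cabs_real (x : R) : cabs (Complex x 0) = `|x|.
Proof. by rewrite /cabs /= expr0n /= addr0 sqrtr_sqr. Qed.

Lemma cabs_nat n : cabs n%:R = n%:R.
Proof.
have -> : (n%:R : C) = Complex (n%:R : R) 0.
  by rewrite -(rmorph_nat (real_complex R)).
by rewrite cabs_real ger0_norm.
Qed.

Lemma cabs_int (n : int) : cabs n%:~R = `|n|%:~R.
Proof.
by case: n => n; rewrite ?NegzE ?mulrNz ?normrN ?cabsN; rewrite cabs_nat.
Qed.

Lemma Re_le_cabs z : `|Re z| <= cabs z.
Proof. by have := normc_ge_Re z; rewrite cabsE lecR. Qed.

Lemma cabs_le_ReIm z : cabs z <= `|Re z| + `|Im z|.
Proof.
case: z => a b; rewrite /cabs /=.
rewrite -(ler_pXn2r (isT : (0 < 2)%N)) ?nnegrE ?sqrtr_ge0 ?addr_ge0 //.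
rewrite sqr_sqrtr ?addr_ge0 ?sqr_ge0 // sqrrD !real_normK ?num_real //.
by rewrite lerD2r lerDl mulrn_wge0 ?mulr_ge0.
Qed.

Lemma Im_le_cabs z : `|Im z| <= cabs z.
Proof.
case: z => a b; rewrite /cabs /= -sqrtr_sqr ler_wsqrtr // lerDr sqr_ge0 //.
Qed.

Lemma cvgCP T (F : set_system T) (FF : Filter F) (f : T -> C) (l : C) :
  f @ F --> l <-> forall e : R, 0 < e -> \forall x \near F, cabs (l - f x) <= e.
Proof.
rewrite cvgrPdist_le; split=> [h e e0|h e].
  have e0' : 0 < e%:C%C :> C by rewrite ltcR.
  by apply: filterS (h _ e0') => x; rewrite cabsE lecR.
case: e => a b; rewrite ltcE /= => /andP[/eqP -> a0].
by apply: filterS (h _ a0) => x; rewrite cabsE lecR.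
Qed.

Lemma cabs_cauchy_cvg (u : nat -> C) :
  (forall e : R, 0 < e -> exists N, forall m n, (N <= m)%N -> (N <= n)%N ->
     cabs (u m - u n) <= e) ->
  exists l : C, u @ \oo --> l.
Proof.
move=> h.
have cv (g : C -> R) : (forall x y, `|g x - g y| <= cabs (x - y)) ->
    exists l : R, (g \o u) @ \oo --> l.
  move=> gl; apply/cvg_ex; apply/cauchy_cvgP/cauchy_ballP => e e0.
  have [N hN] := h (e / 2) (divr_gt0 e0 (ltr0n _ 2)).
  exists ((g \o u) @` [set n | (N <= n)%N], (g \o u) @` [set n | (N <= n)%N]).
    by split; exists N => // n /= Nn; exists n.
  case=> _ _ /= [[m Nm <-] [n Nn <-]]; rewrite /ball /=.
  by rewrite (le_lt_trans (gl _ _)) // (le_lt_trans (hN _ _ Nm Nn)) // gtr_pMr // invf_lt1 // ltr1n.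
have [a ha] : exists l : R, (Re \o u) @ \oo --> l.
  by apply: cv => x y; rewrite (le_trans _ (Re_le_cabs (x - y))) //; case: x y => [? ?] [? ?].
have [b hb] : exists l : R, (Im \o u) @ \oo --> l.
  by apply: cv => x y; rewrite (le_trans _ (Im_le_cabs (x - y))) //; case: x y => [? ?] [? ?].
exists (Complex a b); apply/cvgCP => e e0.
have e2 : 0 < e / 2 by rewrite divr_gt0.
move/cvgrPdist_le: ha => /(_ _ e2) ha; move/cvgrPdist_le: hb => /(_ _ e2) hb.
near=> n.
rewrite (le_trans (cabs_le_ReIm _)) // [leRHS](splitr e) lerD //.
  rewrite (_ : Re (_ - u n) = a - Re (u n)); last by case: (u n).
  by near: n; exact: ha.
rewrite (_ : Im (_ - u n) = b - Im (u n)); last by case: (u n).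
by near: n; exact: hb.
Unshelve. all: by end_near.
Qed.

End ComplexModulus.

(** * The complex exponential *)

Section ComplexExponential.
Variable R : realType.
Local Notation C := (Cplx R).

Lemma expC0 : expC 0 = 1 :> C.
Proof. by rewrite /expC /= expR0 cos0 sin0 mulr0 mulr1. Qed.

Lemma expCD (z w : C) : expC (z + w) = expC z * expC w.
Proof.
case: z w => [a b] [c d]; rewrite /expC /= expRD cosD sinD.
by apply/eqP; rewrite eq_complex /=; apply/andP; split; apply/eqP; ring.
Qed.

Lemma cabs_expC (z : C) : cabs (expC z) = expR (complex.Re z).
Proof.
rewrite /cabs /expC /= !exprMn -mulrDr cos2Dsin2 mulr1 sqrtr_sqr ger0_norm //.
Qed.

Lemma expC_neq0 (z : C) : expC z != 0.
Proof.
apply/eqP => h; have := expR_gt0 (complex.Re z).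
by rewrite -cabs_expC h cabs0 ltxx.
Qed.

Lemma expCN (z : C) : expC (- z) = (expC z)^-1.
Proof.
by apply: (mulfI (expC_neq0 z)); rewrite -expCD subrr expC0 divff // expC_neq0.
Qed.

Lemma expCMn (z : C) n : expC (z * n%:R) = expC z ^+ n.
Proof.
elim: n => [|n ih]; first by rewrite mulr0 expC0.
by rewrite -addn1 natrD mulrDr mulr1 expCD ih addn1 exprSr.
Qed.

Lemma expC_real (x : R) : expC (Complex x 0) = Complex (expR x) 0.
Proof. by rewrite /expC /= cos0 sin0 mulr1 mulr0. Qed.

Lemma norm_expRB1_le (x : R) : `|expR x - 1| <= `|x| * expR `|x|.
Proof.
have h1 := expR_ge1Dx x; have h2 := expR_ge1Dx (- x).
have e : expR x * expR (- x) = 1 by rewrite -expRD subrr expR0.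
have p := expR_gt0 x.
have [x0|x0] := ger0P x.
  by rewrite ger0_norm; nra.
have p2 : expR x <= 1 by rewrite -expR0 ler_expR ltW.
have p3 : 1 <= expR (- x) by rewrite -expR0 ler_expR; lra.
by rewrite ler0_norm; nra.
Qed.

Lemma norm_expRB1Dx_le (x : R) : `|expR x - 1 - x| <= x ^+ 2 * expR `|x|.
Proof.
have h1 := expR_ge1Dx x; have h2 := expR_ge1Dx (- x).
have e : expR x * expR (- x) = 1 by rewrite -expRD subrr expR0.
have p := expR_gt0 x.
rewrite ger0_norm; last by lra.
have k : expR x - 1 <= x * expR x by have := ler_wpM2l (ltW p) h2; rewrite e; lra.
have [x0|x0] := ger0P x.
  by have := ler_wpM2l x0 k; rewrite expr2; lra.
have p2 : 1 <= expR (- x) by rewrite -expR0 ler_expR; lra.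
have h3 : expR x <= 1 by rewrite -expR0 ler_expR; lra.
have : expR x - 1 - x <= x ^+ 2.
  by rewrite expr2; nra.
by move/le_trans; apply; rewrite ler_peMr // sqr_ge0.
Qed.

Lemma norm_sin_le (x : R) : `|sin x| <= `|x|.
Proof.
wlog x0 : x / 0 <= x => [H|].
  have [/H //|x0] := leP 0 x.
  by rewrite -normrN -sinN -(normrN x); apply: H; rewrite oppr_ge0 ltW.
have [->|xn] := eqVneq x 0; first by rewrite sin0.
have x0' : 0 < x by rewrite lt_neqAle eq_sym xn.
have [c _ E] : exists2 c, c \in `]0, x[%R & sin x - sin 0 = cos c * (x - 0).
  apply: (@MVT R sin cos 0 x x0').
  by apply: continuous_subspaceT => y; exact: continuous_sin.
move: E; rewrite sin0 !subr0 => ->.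
by rewrite normrM ler_piMl // cos_max.
Qed.

Lemma norm_cosB1_le (x : R) : `|cos x - 1| <= x ^+ 2 / 2.
Proof.
have -> : cos x = 1 - 2 * sin (x / 2) ^+ 2.
  by rewrite {1}(splitr x) cosD -!expr2 cos2sin2; ring.
rewrite (_ : 1 - _ - 1 = - (2 * sin (x / 2) ^+ 2)); last by ring.
rewrite normrN ger0_norm; last by apply: mulr_ge0; [|exact: sqr_ge0].
have : `|sin (x / 2)| ^+ 2 <= `|x / 2| ^+ 2 by rewrite ler_sqr ?nnegrE // norm_sin_le.
by rewrite !real_normK ?num_real // expr_div_n => h; lra.
Qed.

Lemma norm_sinBx_le (x : R) : `|sin x - x| <= x ^+ 2.
Proof.
wlog x0 : x / 0 <= x => [H|].
  have [/H //|x0] := leP 0 x.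
  rewrite -normrN -sqrrN opprB addrC -[X in X + _]opprK opprK -sinN.
  by rewrite addrC; have := H (- x); rewrite opprK addrC; apply; rewrite oppr_ge0 ltW.
have [->|xn] := eqVneq x 0; first by rewrite sin0 subrr normr0 expr0n.
have x0' : 0 < x by rewrite lt_neqAle eq_sym xn.
have [c /itvP cx E] : exists2 c, c \in `]0, x[%R & sin x - sin 0 = cos c * (x - 0).
  apply: (@MVT R sin cos 0 x x0').
  by apply: continuous_subspaceT => y; exact: continuous_sin.
move: E; rewrite sin0 !subr0 => ->.
rewrite -[X in _ - X]mul1r -mulrBl normrM (ger0_norm x0) expr2 ler_wpM2r //.
have c0 : 0 <= c by rewrite cx.
have cx' : c <= x by rewrite cx.
have [x2|x2] := leP x 2.
  by rewrite (le_trans (norm_cosB1_le c)) //; nra.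
have h1 := cos_le1 c; have h2 := cos_geN1 c.
by rewrite ler0_norm; lra.
Qed.

(** The Taylor remainder bound behind every differentiability statement. *)
Lemma cabs_expC_B1Dz (z : C) :
  cabs (expC z - 1 - z) <= 4 * cabs z ^+ 2 * expR (cabs z).
Proof.
rewrite (le_trans (cabs_le_ReIm _)) //.
have := Re_le_cabs z; have := Im_le_cabs z; have := cabs_ge0 z.
move: (cabs z) => m m0; case: z => x y /= ym xm.
rewrite subr0.
have h1 := norm_expRB1Dx_le x; have h2 := norm_expRB1_le x.
have h3 := norm_cosB1_le y; have h4 := norm_sinBx_le y.
have E := expR_ge0 m; have Ex : expR `|x| <= expR m by rewrite ler_expR.
have Ex' : expR x <= expR m by rewrite ler_expR (le_trans (ler_norm _)).
have y2 : y ^+ 2 <= m ^+ 2 by rewrite -real_normK ?num_real // ler_sqr ?nnegrE.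
have x2 : x ^+ 2 <= m ^+ 2 by rewrite -[x ^+ 2]real_normK ?num_real // ler_sqr ?nnegrE.
have m2 : 0 <= m ^+ 2 by exact: sqr_ge0.
have k1 : `|expR x * cos y - 1 - x| <= m ^+ 2 * expR m + expR m * (m ^+ 2 / 2).
  have -> : expR x * cos y - 1 - x = (expR x - 1 - x) + expR x * (cos y - 1) by ring.
  rewrite (le_trans (ler_normD _ _)) // lerD //.
    by rewrite (le_trans h1) // ler_pM ?sqr_ge0 ?expR_ge0.
  rewrite normrM (ger0_norm (expR_ge0 x)) ler_pM ?expR_ge0 // (le_trans h3) //.
  by rewrite ler_pM2r.
have k2 : `|expR x * sin y - y| <= expR m * m ^+ 2 + m * expR m * m.
  have -> : expR x * sin y - y = expR x * (sin y - y) + (expR x - 1) * y by ring.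
  rewrite (le_trans (ler_normD _ _)) // lerD //.
    by rewrite normrM (ger0_norm (expR_ge0 x)) ler_pM ?expR_ge0 // (le_trans h4).
  rewrite normrM ler_pM // (le_trans h2) // ler_pM ?expR_ge0 //.
rewrite (le_trans (lerD k1 k2)) //.
have := mulr_ge0 m2 E; lra.
Qed.

Lemma cabs_expCB1 (z : C) : cabs (expC z - 1) <= 5 * cabs z * expR (2 * cabs z).
Proof.
have h : cabs (expC z - 1) <= cabs z + 4 * cabs z ^+ 2 * expR (cabs z).
  have -> : expC z - 1 = z + (expC z - 1 - z) by ring.
  by rewrite (le_trans (cabsD _ _)) // lerD // cabs_expC_B1Dz.
apply: (le_trans h); have := cabs_ge0 z; move: (cabs z) => m m0.
have e1 := expR_ge1Dx m.
rewrite (_ : 2 * m = m + m) ?expRD; last by ring.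
have EE : 1 <= expR m * expR m by nra.
have k1 := ler_wpM2l m0 EE.
have k2 : m * expR m <= expR m * expR m by rewrite ler_pM2r ?expR_gt0 //; lra.
by have := ler_wpM2l m0 k2; rewrite expr2; lra.
Qed.

End ComplexExponential.

(** * Summable majorants, series and products *)

Section Summability.
Variable R : realType.
Local Notation C := (Cplx R).

Lemma cabs_lim_le (u : nat -> C) (l : C) (K : R) :
  u @ \oo --> l -> (\forall n \near \oo, cabs (u n) <= K) -> cabs l <= K.
Proof.
move=> /cvgCP ul uK; apply/ler_addgt0Pr => e e0.
have [n _ [h1 h2]] : exists2 n, True & cabs (l - u n) <= e /\ cabs (u n) <= K.
  have /filter_ex [n hn] : \forall n \near \oo, cabs (l - u n) <= e /\ cabs (u n) <= K.
    by apply: filterI => //; exact: ul.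
  by exists n.
by rewrite -(subrK (u n) l) (le_trans (cabsD _ _)) // addrC lerD.
Qed.

Lemma cabs_lim_ge (u : nat -> C) (l : C) (K : R) :
  u @ \oo --> l -> (\forall n \near \oo, K <= cabs (u n)) -> K <= cabs l.
Proof.
move=> /cvgCP ul uK; apply/ler_addgt0Pr => e e0.
have /filter_ex [n [h1 h2]] : \forall n \near \oo, cabs (l - u n) <= e /\ K <= cabs (u n).
  by apply: filterI => //; exact: ul.
rewrite (le_trans h2) // -(subKr l (u n)) (le_trans (cabsB _ _)) //.
by rewrite lerD2l.
Qed.

(** Sequences of nonnegative reals with bounded partial sums. *)
Definition sum_bounded (K : nat -> R) : Prop :=
  (forall n, 0 <= K n) /\ exists M, forall N, \sum_(0 <= n < N) K n <= M.

Lemma sum_bounded_tail K : sum_bounded K -> forall e, 0 < e ->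
  exists N, forall m n, (N <= m <= n)%N -> \sum_(m <= k < n) K k <= e.
Proof.
move=> [K0 [M KM]] e e0.
pose S n := \sum_(0 <= k < n) K k.
have Sm : {homo S : m n / (m <= n)%N >-> m <= n}.
  move=> m n mn; rewrite /S (big_cat_nat (leq0n _) mn) //= lerDl sumr_ge0 //.
have ubS : ubound (range S) M by move=> _ [n _ <-]; exact: KM.
have hS : has_sup (range S) by split; [exists (S 0%N); exists 0%N | exists M].
have [_ [N _ <-] SN] := sup_adherent e0 hS.
exists N => m n /andP[Nm mn].
have h1 : S n <= sup (range S) by apply: ub_le_sup; [exists M | exists n].
have h2 := Sm _ _ Nm.
have -> : \sum_(m <= k < n) K k = S n - S m.
  by rewrite /S (big_cat_nat (leq0n _) mn) //= addrAC subrr add0r.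
lra.
Qed.

(** Weierstrass M-test, for a single point. *)
Lemma series_cvg (u : nat -> C) K : sum_bounded K ->
  (forall n, cabs (u n) <= K n) ->
  exists l : C, (fun N => \sum_(0 <= n < N) u n) @ \oo --> l.
Proof.
move=> bK uK; apply: cabs_cauchy_cvg => e e0.
have [N hN] := sum_bounded_tail bK e0.
have H m n : (N <= m <= n)%N ->
    cabs (\sum_(0 <= k < n) u k - \sum_(0 <= k < m) u k) <= e.
  move=> /[dup] Nmn /andP[_ mn]; rewrite (big_cat_nat (leq0n _) mn) //= addrAC subrr add0r.
  rewrite (le_trans (cabs_sum _ _ _)) // (le_trans _ (hN _ _ Nmn)) //.
  exact: ler_sum.
exists N => m n Nm Nn; have [mn|/ltnW nm] := leqP m n.
  by rewrite cabs_distC H // Nm.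
by rewrite H // Nn.
Qed.

Lemma prod_1D_le_expR (K : nat -> R) m n : (forall n, 0 <= K n) ->
  \prod_(m <= k < n) (1 + K k) <= expR (\sum_(m <= k < n) K k).
Proof.
move=> K0; rewrite expR_sum; apply: ler_prod => k _.
by rewrite expR_ge1Dx addr_ge0.
Qed.

Lemma prod_cvg (u : nat -> C) K : sum_bounded K ->
  (forall n, cabs (u n) <= K n) ->
  exists l : C, (fun N => \prod_(0 <= n < N) (1 + u n)) @ \oo --> l.
Proof.
move=> [K0 [M KM]] uK.
(* partial products are partial sums of the series [P n * u n] *)
pose P N := \prod_(0 <= n < N) (1 + u n).
have PE N : P N = 1 + \sum_(0 <= n < N) P n * u n.
  elim: N => [|N ih]; first by rewrite /P !big_geq // addr0.
  by rewrite {1}/P !big_nat_recr //= -/(P N) mulrDr mulr1 addrA -ih.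
have PM N : cabs (P N) <= expR M.
  rewrite /P cabs_prod (@le_trans _ _ (\prod_(0 <= k < N) (1 + K k))) //.
    apply: ler_prod => k _; rewrite cabs_ge0 /=.
    by rewrite (le_trans (cabsD _ _)) // cabs1 lerD2l.
  by rewrite (le_trans (prod_1D_le_expR _ _ K0)) // ler_expR.
have [l hl] : exists l : C, (fun N => \sum_(0 <= n < N) P n * u n) @ \oo --> l.
  apply: (@series_cvg _ (fun n => expR M * K n)); last first.
    by move=> n; rewrite cabsM ler_pM ?cabs_ge0.
  split=> [n|]; first by rewrite mulr_ge0 ?expR_ge0.
  by exists (expR M * M) => N; rewrite -mulr_sumr ler_pM2l ?expR_gt0.
exists (1 + l).
under eq_fun do rewrite -/(P _) PE.
by apply: cvgD hl; exact: cvg_cst.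
Qed.

Lemma prod_1D_ge (K : nat -> R) (v : nat -> R) m n :
  (forall k, 1 - K k <= v k) -> (forall k, 0 <= v k) -> (forall k, 0 <= K k) ->
  1 - \sum_(m <= k < n) K k <= \prod_(m <= k < n) v k.
Proof.
move=> h v0 K0; have [mn|mn] := leqP m n; last first.
  by rewrite !big_geq ?(ltnW mn) // subr0.
rewrite -(subnKC mn); elim: (n - m)%N => [|j ih].
  by rewrite addn0 !big_geq // subr0.
rewrite addnS !big_nat_recr ?leq_addr //=.
have S0 : 0 <= \sum_(m <= k < m + j) K k by apply: sumr_ge0.
have P0 : 0 <= \prod_(m <= k < m + j) v k by apply: prodr_ge0.
have [k1|k1] := leP 1 (K (m + j)%N).
  by rewrite (@le_trans _ _ 0) ?mulr_ge0 //; lra.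
have k2 := ler_wpM2l P0 (h (m + j)%N).
have k3 := mulr_ge0 S0 (K0 (m + j)%N).
have : (1 - K (m + j)%N) * (1 - \sum_(m <= k < m + j) K k) <=
   (1 - K (m + j)%N) * \prod_(m <= k < m + j) v k by rewrite ler_pM2l // subr_gt0.
lra.
Qed.

(** The factors from some index on contribute at least [1/2] in modulus. *)
Lemma prod_lim_neq0 (u : nat -> C) K l : sum_bounded K ->
  (forall n, cabs (u n) <= K n) -> (forall n, 1 + u n != 0) ->
  (fun N => \prod_(0 <= n < N) (1 + u n)) @ \oo --> l -> l != 0.
Proof.
move=> bK uK u0 ul.
have h2 : 0 < 2^-1 :> R by rewrite invr_gt0.
have [N hN] := sum_bounded_tail bK h2.
pose P n := \prod_(0 <= k < n) (1 + u k).
have PN : 0 < cabs (P N).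
  apply: cabs_gt0; rewrite /P big_seq prodf_seq_neq0; apply/allP => k _.
  by rewrite u0 implybT.
suff : cabs (P N) / 2 <= cabs l.
  move=> h; apply/eqP => l0; move: h; rewrite l0 cabs0; lra.
apply: (cabs_lim_ge ul); exists N => // n /= Nn.
rewrite (big_cat_nat (leq0n _) Nn) //= cabsM -/(P N) ler_pM2l // cabs_prod.
apply: (@le_trans _ _ (1 - \sum_(N <= k < n) K k)).
  by have := hN N n; rewrite leqnn Nn => /(_ isT); lra.
apply: prod_1D_ge => k; last exact: bK.1.
  by rewrite (le_trans _ (cabsB_ge _ _)) // cabs1 lerB.
exact: cabs_ge0.
Qed.

End Summability.

(** * Quadratic Taylor bounds and differentiability of limits *)

Section Jets.
Variable R : realType.
Local Notation C := (Cplx R).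

(** [jet z r f K]: near [z], up to distance [r], the function [f] has a linear
    approximation with quadratic error, and the size of [f z], of the slope and
    of the error constant add up to at most [K].  For [r <= 1] this bound is
    submultiplicative and it passes to pointwise limits. *)
Definition jet (z : C) (r : R) (f : C -> C) (K : R) : Prop :=
  exists (d : C) (q : R), [/\ 0 <= q, cabs (f z) + cabs d + q <= K &
    forall h, cabs h <= r -> cabs (f (z + h) - f z - d * h) <= q * cabs h ^+ 2].

Variables (z : C) (r : R).
Hypotheses (r0 : 0 < r) (r1 : r <= 1).

Lemma jet_ge0 f K : jet z r f K -> 0 <= K.
Proof. by move=> [d [q [q0 hK _]]]; have := cabs_ge0 (f z); have := cabs_ge0 d; lra. Qed.

Lemma jet_le f K K' : K <= K' -> jet z r f K -> jet z r f K'.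
Proof. by move=> KK [d [q [q0 hK h]]]; exists d, q; split=> //; lra. Qed.

(** The bound controls the function on the whole disc of radius [r]. *)
Lemma jet_bound f K h : jet z r f K -> cabs h <= r -> cabs (f (z + h)) <= K.
Proof.
move=> [d [q [q0 hK H]]] hr.
have -> : f (z + h) = (f (z + h) - f z - d * h) + (f z + d * h) by ring.
have h0 := cabs_ge0 h; have d0 := cabs_ge0 d; have hr1 := le_trans hr r1.
have h1 : cabs h ^+ 2 <= 1 by rewrite expr_le1 // (le_trans hr).
have := cabsD (f (z + h) - f z - d * h) (f z + d * h); have := cabsD (f z) (d * h).
rewrite cabsM; have := H h hr.
have : cabs d * cabs h <= cabs d by rewrite ler_piMr //; lra.
have : q * cabs h ^+ 2 <= q by rewrite ler_piMr.
lra.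
Qed.

Lemma jet_cst (c : C) : jet z r (fun=> c) (cabs c).
Proof.
exists 0, 0; split=> // [|h _]; first by rewrite cabs0 !addr0.
by rewrite subrr mul0r subr0 cabs0 mul0r.
Qed.

Lemma jet_id : jet z r id (cabs z + 1).
Proof.
exists 1, 0; split=> // [|h _]; first by rewrite cabs1 addr0.
have -> : id (z + h) - id z - 1 * h = 0 by rewrite /=; ring.
by rewrite cabs0 mul0r.
Qed.

Lemma jetD f g K L : jet z r f K -> jet z r g L -> jet z r (fun s => f s + g s) (K + L).
Proof.
move=> [d [q [q0 hK H]]] [d' [q' [q0' hK' H']]].
exists (d + d'), (q + q'); split=> [||h hr].
- exact: addr_ge0.
- by have := cabsD (f z) (g z); have := cabsD d d'; lra.
- have -> : f (z + h) + g (z + h) - (f z + g z) - (d + d') * h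
    = (f (z + h) - f z - d * h) + (g (z + h) - g z - d' * h) by ring.
  by rewrite (le_trans (cabsD _ _)) // mulrDl lerD ?H ?H'.
Qed.

Lemma jetN f K : jet z r f K -> jet z r (fun s => - f s) K.
Proof.
move=> [d [q [q0 hK H]]]; exists (- d), q; split=> // [|h hr]; first by rewrite !cabsN.
have -> : - f (z + h) - - f z - - d * h = - (f (z + h) - f z - d * h) by ring.
by rewrite cabsN H.
Qed.

Lemma jetM f g K L : jet z r f K -> jet z r g L -> jet z r (fun s => f s * g s) (K * L).
Proof.
move=> jf jg; have jgb := jet_bound jg.
move: jf jg => [d [q [q0 hK H]]] [d' [q' [q0' hL H']]].
have a0 := cabs_ge0 (f z); have b0 := cabs_ge0 (g z).
have d0 := cabs_ge0 d; have d0' := cabs_ge0 d'.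
exists (f z * d' + d * g z),
  (cabs (f z) * q' + q * (cabs (g z) + cabs d' + q') + cabs d * (cabs d' + q')).
split=> [||h hr].
- by rewrite !addr_ge0 ?mulr_ge0 ?addr_ge0.
- have k1 := cabsD (f z * d') (d * g z); rewrite !cabsM in k1.
  apply: (@le_trans _ _ ((cabs (f z) + cabs d + q) * (cabs (g z) + cabs d' + q'))).
    by rewrite cabsM; lra.
  by rewrite ler_pM ?addr_ge0.
set a := f (z + h) - f z - d * h; set b := g (z + h) - g z - d' * h.
have -> : f (z + h) * g (z + h) - f z * g z - (f z * d' + d * g z) * h
    = f z * b + a * g (z + h) + d * h * (d' * h + b) by rewrite /a /b; ring.
have Ha := H h hr; have Hb := H' h hr; rewrite -/a in Ha; rewrite -/b in Hb.
clearbody a b.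
have h0 := cabs_ge0 h; have hr1 := le_trans hr r1.
have gb : cabs (g (z + h)) <= cabs (g z) + cabs d' + q'.
  by apply: jet_bound hr; exists d', q'.
have h2 : 0 <= cabs h ^+ 2 by apply: sqr_ge0.
have h2' : cabs h ^+ 2 <= cabs h by rewrite expr2 ler_piMr //; lra.
rewrite (le_trans (cabsD _ _)) // !mulrDl; apply: lerD.
  rewrite (le_trans (cabsD _ _)) // !cabsM; apply: lerD.
    by rewrite -mulrA ler_wpM2l.
  rewrite [X in _ <= X](_ : _ = q * cabs h ^+ 2 * (cabs (g z) + cabs d' + q')); last by ring.
  by rewrite ler_pM ?cabs_ge0.
rewrite !cabsM -!mulrA ler_wpM2l // mulrDl.
have k : cabs (d' * h + b) <= (cabs d' + q') * cabs h.
  rewrite (le_trans (cabsD _ _)) // cabsM mulrDl lerD2l (le_trans Hb) //.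
  by rewrite ler_wpM2l.
by rewrite (le_trans (ler_wpM2l h0 k)) //; lra.
Qed.

Lemma jet_sum (u : nat -> C -> C) K m n : (forall k, jet z r (u k) (K k)) ->
  jet z r (fun s => \sum_(m <= k < n) u k s) (\sum_(m <= k < n) K k).
Proof.
move=> uK; rewrite /index_iota; elim: (iota _ _) => [|k s ih].
  rewrite big_nil -cabs0; have := jet_cst 0.
  by rewrite (_ : (fun s => \sum_(k <- [::]) u k s) = (fun=> 0)) //; apply/funext => s; rewrite big_nil.
rewrite big_cons (_ : (fun s => _) = (fun x => u k x + \sum_(k <- s) u k x)).
  exact: jetD.
by apply/funext => x; rewrite big_cons.
Qed.

Lemma jet_prod (u : nat -> C -> C) K m n : (forall k, jet z r (u k) (K k)) ->
  jet z r (fun s => \prod_(m <= k < n) (1 + u k s)) (expR (\sum_(m <= k < n) K k)).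
Proof.
move=> uK.
have : jet z r (fun s => \prod_(m <= k < n) (1 + u k s)) (\prod_(m <= k < n) (1 + K k)).
  rewrite /index_iota; elim: (iota _ _) => [|k s ih].
    rewrite big_nil -(@cabs1 R); have := jet_cst 1.
    by rewrite (_ : (fun s => \prod_(k <- [::]) _) = (fun=> 1)) //; apply/funext => s; rewrite big_nil.
  rewrite big_cons (_ : (fun s => _) = (fun x => (1 + u k x) * \prod_(k <- s) (1 + u k x))).
    by apply: jetM => //; apply: jetD => //; rewrite -[1 in X in jet _ _ _ X](@cabs1 R); exact: jet_cst.
  by apply/funext => x; rewrite big_cons.
by apply: jet_le; apply: prod_1D_le_expR => k; exact: jet_ge0 (uK k).
Qed.

(** The difference quotients [phi h] satisfy
    [|phi h - phi h'| <= K (|h| + |h'|)]; this passes to the limit function, so its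
    quotients are Cauchy as [h] tends to 0. *)
Lemma jet_lim_derivable (g : nat -> C -> C) (f : C -> C) K :
  (forall n, jet z r (g n) K) ->
  (forall h, cabs h <= r -> (fun n => g n (z + h)) @ \oo --> f (z + h)) ->
  derivable (f : C^o -> C^o) z 1.
Proof.
move=> jg gf; have K0 := jet_ge0 (jg 0%N).
pose phi (F : C -> C) h := h^-1 * (F (z + h) - F z).
have phiB n h h' : h != 0 -> h' != 0 -> cabs h <= r -> cabs h' <= r ->
    cabs (phi (g n) h - phi (g n) h') <= K * (cabs h + cabs h').
  have [d [q [q0 hK H]]] := jg n.
  have E k : k != 0 -> cabs k <= r -> cabs (phi (g n) k - d) <= K * cabs k.
    move=> k0 kr.
    have -> : phi (g n) k - d = k^-1 * (g n (z + k) - g n z - d * k).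
      by rewrite /phi; field.
    have kp := cabs_gt0 k0.
    rewrite cabsM cabsV ler_pdivrMl // (le_trans (H k kr)) // [leRHS]mulrCA -expr2.
    by rewrite ler_wpM2r ?sqr_ge0 //; have := cabs_ge0 (g n z); have := cabs_ge0 d; lra.
  move=> h0 h0' hr hr'.
  have -> : phi (g n) h - phi (g n) h' = (phi (g n) h - d) - (phi (g n) h' - d) by ring.
  by rewrite (le_trans (cabsB _ _)) // mulrDr lerD ?E.
have gfz : (fun n => g n z) @ \oo --> f z.
  by have := gf 0; rewrite addr0; apply; rewrite cabs0 ltW.
have phic h : cabs h <= r -> (fun n => phi (g n) h) @ \oo --> phi f h.
  move=> hr; apply: cvgM; first exact: cvg_cst.
  exact: (cvgB (gf h hr) gfz).
have phiC h h' : h != 0 -> h' != 0 -> cabs h <= r -> cabs h' <= r ->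
    cabs (phi f h - phi f h') <= K * (cabs h + cabs h').
  move=> h0 h0' hr hr'.
  apply: (@cabs_lim_le _ (fun n => phi (g n) h - phi (g n) h')).
    exact: (cvgB (phic h hr) (phic h' hr')).
  by apply: nearW => n; exact: phiB.
(* a sequence of increments tending to 0, along which the limit is taken *)
pose e n : C := Complex (r / n.+1%:R) 0.
have ce n : cabs (e n) = r / n.+1%:R by rewrite cabs_real ger0_norm // divr_ge0 // ltW.
have er n : cabs (e n) <= r by rewrite ce ler_pdivrMr // ler_peMr ?ler1n // ltW.
have e0 n : e n != 0.
  by apply/eqP => en; have := ce n; rewrite en cabs0 => /esym/eqP; rewrite gt_eqF // divr_gt0.
have small (eps : R) : 0 < eps -> exists N, forall n, (N <= n)%N -> K * cabs (e n) <= eps.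
  move=> eps0; have [N hN] : exists N : nat, K * r / eps <= N%:R.
    by exists (Num.truncn (K * r / eps)).+1; rewrite ltW // truncnS_gt.
  exists N => n Nn; rewrite ce mulrA ler_pdivrMr //.
  rewrite ler_pdivrMr // in hN; rewrite (le_trans hN) // mulrC ler_pM2l //.
  by rewrite ler_nat (leq_trans Nn).
have [d hd] : exists d : C, (fun n => phi f (e n)) @ \oo --> d.
  apply: cabs_cauchy_cvg => eps eps0.
  have [N hN] := small _ (divr_gt0 eps0 (ltr0n R 2)).
  exists N => m n Nm Nn; rewrite (le_trans (phiC _ _ _ _ _ _)) //.
  by rewrite mulrDr [leRHS](splitr eps) lerD ?hN.
have Hd h : h != 0 -> cabs h <= r -> cabs (phi f h - d) <= K * cabs h.
  move=> h0 hr; apply/ler_addgt0Pr => eps eps0.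
  have [N hN] := small _ eps0.
  apply: (@cabs_lim_le _ (fun n => phi f h - phi f (e n))).
    exact: (cvgB (cvg_cst (phi f h)) hd).
  exists N => // n /= Nn; rewrite (le_trans (phiC _ _ _ _ _ _)) // mulrDr lerD2l.
  exact: hN.
apply/cvg_ex; exists d; apply/cvgCP => eps eps0.
have del : 0 < Num.min r (eps / (K + 1)).
  by rewrite lt_min r0 divr_gt0 //; lra.
have nh : \forall h \near (0 : C)^', cabs h <= Num.min r (eps / (K + 1)).
  apply: nbhs_dnbhs.
  have /cvgCP /(_ _ del) : (id : C -> C) @ (0 : C) --> (0 : C) by exact: cvg_id.
  by apply: filterS => h; rewrite sub0r cabsN.
near=> h.
have hs : cabs h <= Num.min r (eps / (K + 1)) by near: h; exact: nh.
move: hs; rewrite le_min => /andP[hr he].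
have h0 : h != 0 by near: h; exact: nbhs_dnbhs_neq.
have := Hd h h0 hr; rewrite cabs_distC => hh.
rewrite (_ : _ *: _ = phi f h); last by rewrite /phi /= [h%:A](mulr1 h) (addrC h z).
rewrite (le_trans hh) // (le_trans (ler_wpM2l K0 he)) // mulrA ler_pdivrMr; nra.
Unshelve. all: by end_near.
Qed.

End Jets.

(** * Differentiable infinite sums and products *)

Section InfiniteSumsAndProducts.
Variable R : realType.
Local Notation C := (Cplx R).

(** The pointwise sum of a series of functions. *)
Definition infsum (u : nat -> C -> C) (s : C) : C :=
  lim ((fun N => \sum_(0 <= n < N) u n s) @ \oo).

(** The pointwise infinite product of the functions [1 + u n]. *)
Definition infprod (u : nat -> C -> C) (s : C) : C :=
  lim ((fun N => \prod_(0 <= n < N) (1 + u n s)) @ \oo).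

Lemma cvg_limC (u : nat -> C) (l : C) : u @ \oo --> l -> lim (u @ \oo) = l.
Proof. by apply: cvg_lim; exact: norm_hausdorff. Qed.

Variables (z : C) (r : R) (u : nat -> C -> C) (K : nat -> R).
Hypotheses (r0 : 0 < r) (r1 : r <= 1).
Hypotheses (bK : sum_bounded K) (uK : forall n, jet z r (u n) (K n)).

Lemma cvg_infsum h : cabs h <= r ->
  (fun N => \sum_(0 <= n < N) u n (z + h)) @ \oo --> infsum u (z + h).
Proof.
move=> hr; have [l hl] := series_cvg bK (fun n => jet_bound r1 (uK n) hr).
by rewrite /infsum (cvg_limC hl).
Qed.

Lemma cvg_infprod h : cabs h <= r ->
  (fun N => \prod_(0 <= n < N) (1 + u n (z + h))) @ \oo --> infprod u (z + h).
Proof.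
move=> hr; have [l hl] := prod_cvg bK (fun n => jet_bound r1 (uK n) hr).
by rewrite /infprod (cvg_limC hl).
Qed.

Lemma derivable_infsum : derivable (infsum u : C^o -> C^o) z 1.
Proof.
have [K0 [M KM]] := bK.
apply: (@jet_lim_derivable _ z r r0 (fun N s => \sum_(0 <= n < N) u n s) _ M).
  by move=> N; apply: jet_le (KM N) _; apply: jet_sum.
exact: cvg_infsum.
Qed.

Lemma derivable_infprod : derivable (infprod u : C^o -> C^o) z 1.
Proof.
have [K0 [M KM]] := bK.
apply: (@jet_lim_derivable _ z r r0 (fun N s => \prod_(0 <= n < N) (1 + u n s)) _ (expR M)).
  move=> N; apply: (@jet_le _ _ _ _ (expR (\sum_(0 <= n < N) K n))).
    by rewrite ler_expR.
  exact: jet_prod.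
exact: cvg_infprod.
Qed.

Lemma infprod_neq0 : (forall n, 1 + u n z != 0) -> infprod u z != 0.
Proof.
have z0 : cabs 0 <= r by rewrite cabs0 ltW.
have uz n : cabs (u n z) <= K n by have := jet_bound r1 (uK n) z0; rewrite addr0.
move=> h; apply: (prod_lim_neq0 bK uz h).
by have := cvg_infprod z0; rewrite addr0.
Qed.

End InfiniteSumsAndProducts.

(** * Powers of integers as functions of the exponent *)

Section Domination.
Variable R : realType.
Local Notation C := (Cplx R).

(** The logarithm of an integer; [ln_nat 0 = 0]. *)
Definition ln_nat (n : nat) : R := ln (n%:R : R).
Local Notation L := ln_nat.

Lemma ln_nat_ge0 n : 0 <= L n.
Proof.
by case: n => [|n]; [rewrite /ln_nat ln0 | apply: ln_ge0; rewrite ler1n].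
Qed.

Lemma expR_ln_nat n : (0 < n)%N -> expR (L n) = n%:R.
Proof. by move=> n0; rewrite lnK // posrE ltr0n. Qed.

Lemma ln_nat_succ_ge n : (0 < n)%N -> L n + (n.+1%:R)^-1 <= L n.+1.
Proof.
move=> n0; have n1 : 0 < n.+1%:R :> R by rewrite ltr0n.
have np : 0 < n%:R :> R by rewrite ltr0n.
have h : -1 < - (n.+1%:R)^-1 :> R by rewrite ltrN2 invf_lt1 // ltr1n ltnS.
have := le_ln1Dx h.
have -> : 1 - (n.+1%:R)^-1 = n%:R / n.+1%:R :> R.
  by apply: (mulIf (lt0r_neq0 n1)); rewrite divfK ?lt0r_neq0 // mulrBl mul1r mulVf ?lt0r_neq0 // -natr1 addrK.
by rewrite ln_div ?posrE // /ln_nat; move: (ln _) (ln _) (_^-1) => *; lra.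
Qed.

Lemma ln_nat_succ_le n : (0 < n)%N -> L n.+1 <= L n + (n%:R)^-1.
Proof.
move=> n0; have n1 : 0 < n.+1%:R :> R by rewrite ltr0n.
have np : 0 < n%:R :> R by rewrite ltr0n.
have h : -1 < (n%:R)^-1 :> R by rewrite (lt_trans (ltrN10 _)) // invr_gt0.
have := le_ln1Dx h.
have -> : 1 + (n%:R)^-1 = n.+1%:R / n%:R :> R.
  by apply: (mulIf (lt0r_neq0 np)); rewrite divfK ?lt0r_neq0 // mulrDl mul1r mulVf ?lt0r_neq0 // natr1.
by rewrite ln_div ?posrE // /ln_nat; move: (ln _) (ln _) (_^-1) => *; lra.
Qed.

(** The term of index [n + 1] is at most [(n^-c - (n+1)^-c) / c], and these
    bounds telescope. *)
Lemma p_series_bounded (c : R) : 0 < c -> sum_bounded (fun n => expR (- (1 + c) * L n)).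
Proof.
move=> c0; split=> [n|]; first exact: expR_ge0.
have c0' : 0 < c^-1 by rewrite invr_gt0.
exists (2 + c^-1) => N.
have H : \sum_(0 <= n < N.+2) expR (- (1 + c) * L n) <= 2 + c^-1 * (1 - expR (- c * L N.+1)).
  elim: N => [|N ih].
    by rewrite !big_nat_recr // big_geq //= /L ln0 // ln1 !mulr0 expR0 subrr mulr0; lra.
  rewrite big_nat_recr //=.
  suff : expR (- (1 + c) * L N.+2) <= c^-1 * (expR (- c * L N.+1) - expR (- c * L N.+2)) by lra.
  have h := @ln_nat_succ_ge N.+1 isT.
  rewrite ler_pdivlMl //.
  have -> : - (1 + c) * L N.+2 = - c * L N.+2 + - L N.+2 by ring.
  rewrite expRD expRN expR_ln_nat //.
  have -> : - c * L N.+1 = - c * L N.+2 + c * (L N.+2 - L N.+1) by ring.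
  rewrite expRD.
  have h2 := expR_ge1Dx (c * (L N.+2 - L N.+1)).
  have h3 : c * (N.+2%:R)^-1 <= c * (L N.+2 - L N.+1) by rewrite ler_pM2l // lerBrDl.
  rewrite mulrCA -[leLHS]mulrC -[X in _ - X]mul1r [X in X - _]mulrC -mulrBl.
  by rewrite ler_pM2r ?expR_gt0 // (le_trans h3) // lerBrDl.
have H2 : \sum_(0 <= n < N) expR (- (1 + c) * L n) <= \sum_(0 <= n < N.+2) expR (- (1 + c) * L n).
  rewrite !big_nat_recr //= -addrA lerDl addr_ge0 ?expR_ge0 //.
apply: (le_trans H2); apply: (le_trans H).
by rewrite lerD2l ler_piMr ?ltW //; have := expR_gt0 (- c * L N.+1); lra.
Qed.

(** Convergence only depends on the bounds for large [n]. *)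
Lemma dominated_jets (z : C) (r : R) (u : nat -> C -> C) (A c : R) (N0 : nat) :
  0 < c -> (forall n, exists k, jet z r (u n) k) ->
  (forall n, (N0 <= n)%N -> jet z r (u n) (A * expR (- (1 + c) * L n))) ->
  exists K, sum_bounded K /\ forall n, jet z r (u n) (K n).
Proof.
move=> c0 /choice [k hk] hA.
pose K n := if (n < N0)%N then k n else A * expR (- (1 + c) * L n).
have jK n : jet z r (u n) (K n) by rewrite /K; case: ltnP => // /hA.
exists K; split=> //; split=> [n|]; first exact: jet_ge0 (jK n).
have k0 n : 0 <= k n by exact: jet_ge0 (hk n).
have [E0 [M EM]] := p_series_bounded c0.
exists (\sum_(0 <= n < N0) k n + `|A| * M) => N.
have : \sum_(0 <= n < N) K n <= \sum_(0 <= n < N) (if (n < N0)%N then k n else 0)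
   + `|A| * \sum_(0 <= n < N) expR (- (1 + c) * L n).
  rewrite mulr_sumr -big_split /=; apply: ler_sum => n _; rewrite /K.
  case: ifP => _; first by rewrite lerDl mulr_ge0 ?expR_ge0.
  by rewrite add0r ler_pM2r ?expR_gt0 ?ler_norm.
move/le_trans; apply; apply: lerD; last by rewrite ler_wpM2l.
have [NN|NN] := leqP N N0.
  rewrite (big_cat_nat (leq0n _) NN) //= -[leLHS]addr0 lerD ?sumr_ge0 //.
  by apply: ler_sum => n _; case: ifP.
have tail0 : \sum_(N0 <= n < N) (if (n < N0)%N then k n else 0) = 0.
  by rewrite big_nat_cond big1 // => n /andP[/andP[h _] _]; rewrite ltnNge h.
rewrite (big_cat_nat (leq0n _) (ltnW NN)) //= tail0 addr0.
by apply: ler_sum => n _; case: ifP.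
Qed.

Lemma poly_le_expR (eta x : R) : 0 < eta -> 0 <= x ->
  1 + x + 4 * x ^+ 2 <= (1 + eta^-1 + 16 * eta^-1 ^+ 2) * expR (eta * x).
Proof.
move=> e0 x0.
have h : (1 + eta * x / 2) ^+ 2 <= expR (eta * x).
  rewrite {2}(splitr (eta * x)) expRD -expr2 ler_sqr ?nnegrE ?expR_ge0 //.
    exact: expR_ge1Dx.
  by have := mulr_ge0 (ltW e0) x0; lra.
have i0 : 0 < eta^-1 by rewrite invr_gt0.
apply: (le_trans _ (ler_wpM2l _ h)); last first.
  by have := sqr_ge0 eta^-1; lra.
pose y := eta * x; have -> : x = eta^-1 * y by rewrite /y mulKf // lt0r_neq0.
have y0 : 0 <= y by rewrite mulr_ge0 // ltW.
rewrite mulVKf ?lt0r_neq0 //.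
have i2 := sqr_ge0 eta^-1; have y2 := sqr_ge0 y.
move: (eta^-1) i0 i2 => t t0 t2.
rewrite exprMn.
have := mulr_ge0 t2 y2; have := mulr_ge0 t2 y0; have := mulr_ge0 (ltW t0) y2;
have := mulr_ge0 (ltW t0) y0; rewrite !expr2 => *; nra.
Qed.

Lemma jet_expC (z : C) (r : R) (b c : C) : 0 < r -> r <= 1 ->
  jet z r (fun s => expC (b + c * s))
    (expR (complex.Re (b + c * z)) * ((1 + cabs c + 4 * cabs c ^+ 2) * expR (r * cabs c))).
Proof.
move=> r0 r1; set E := expR _; have E0 : 0 < E by exact: expR_gt0.
have c0 := cabs_ge0 c; have c2 : 0 <= cabs c ^+ 2 by exact: sqr_ge0.
have er : 1 <= expR (r * cabs c) by rewrite -expR0 ler_expR mulr_ge0 // ltW.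
exists (expC (b + c * z) * c), (E * (4 * cabs c ^+ 2 * expR (r * cabs c))); split.
- by rewrite !mulr_ge0 ?expR_ge0 // ltW.
- rewrite cabsM cabs_expC -/E.
  rewrite -[X in X + _ + _]mulr1 -!mulrDr ler_pM2l //.
  have := ler_wpM2l c0 er; lra.
move=> h hr.
have -> : expC (b + c * (z + h)) - expC (b + c * z) - expC (b + c * z) * c * h =
   expC (b + c * z) * (expC (c * h) - 1 - c * h).
  by rewrite (_ : b + c * (z + h) = (b + c * z) + c * h) ?expCD; ring.
rewrite cabsM cabs_expC -/E -mulrA ler_pM2l // (le_trans (cabs_expC_B1Dz _)) //.
rewrite cabsM exprMn.
rewrite [leRHS](_ : _ = 4 * (cabs c ^+ 2 * cabs h ^+ 2) * expR (r * cabs c)); last by ring.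
apply: ler_wpM2l; first by rewrite !mulr_ge0 ?cabs_ge0 ?sqr_ge0.
by rewrite ler_expR mulrC ler_wpM2r.
Qed.

Lemma natpowCE n (s : C) : natpowC n s = expC (s * Complex (L n) 0).
Proof. by []. Qed.

Lemma cabs_natpowC n (s : C) : cabs (natpowC n s) = expR (complex.Re s * L n).
Proof. by rewrite cabs_expC; case: s => a b /=; rewrite mulr0 subr0. Qed.

Lemma natpowCD n (s t : C) : natpowC n (s + t) = natpowC n s * natpowC n t.
Proof. by rewrite /natpowC mulrDl expCD. Qed.

Lemma natpowC0 n : natpowC n 0 = 1 :> C.
Proof. by rewrite /natpowC mul0r expC0. Qed.

Lemma natpowCN n (s : C) : natpowC n (- s) = (natpowC n s)^-1.
Proof. by rewrite /natpowC mulNr expCN. Qed.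

Lemma natpowC_nat n k : (0 < n)%N -> natpowC n (k%:R : C) = n%:R ^+ k.
Proof.
move=> n0; rewrite /natpowC mulrC expCMn expC_real; congr (_ ^+ k).
rewrite lnK ?posrE ?ltr0n //.
by rewrite -(rmorph_nat (real_complex R)).
Qed.

Lemma natpowCM m n (s : C) : (0 < m)%N -> (0 < n)%N ->
  natpowC (m * n) s = natpowC m s * natpowC n s.
Proof.
move=> m0 n0; rewrite /natpowC -expCD -mulrDr; congr (expC (_ * _)).
rewrite natrM lnM ?posrE ?ltr0n //.
by apply/eqP; rewrite eq_complex /= addr0 !eqxx.
Qed.

(** Powers [n^(b - a s)]: the losses [r] and [eta] in the exponent absorb the
    variation over the disc and the powers of [ln n]. *)
Lemma jet_natpowC (z : C) (r eta : R) n (a b : R) : 0 < r -> r <= 1 -> 0 < eta ->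
  0 <= a ->
  jet z r (fun s => natpowC n (Complex b 0 - Complex a 0 * s))
   ((1 + eta^-1 + 16 * eta^-1 ^+ 2) *
     expR ((b - a * complex.Re z + a * (r + eta)) * L n)).
Proof.
move=> r0 r1 e0 a0; have L0 := ln_nat_ge0 n.
pose c : C := Complex (- (a * L n)) 0; pose d : C := Complex (b * L n) 0.
have E s : natpowC n (Complex b 0 - Complex a 0 * s) = expC (d + c * s).
  rewrite natpowCE /c /d; congr expC; case: s => x y.
  by apply/eqP; rewrite eq_complex /=; apply/andP; split; apply/eqP; ring.
have -> : (fun s => natpowC n (Complex b 0 - Complex a 0 * s)) = (fun s => expC (d + c * s)).
  exact/funext.
have cE : cabs c = a * L n by rewrite cabs_real normrN ger0_norm ?mulr_ge0.
apply: jet_le (jet_expC z d c r0 r1); rewrite cE.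
have -> : complex.Re (d + c * z) = (b - a * complex.Re z) * L n.
  by case: z {E} => x y /=; ring.
have := poly_le_expR e0 (mulr_ge0 a0 L0).
set P := 1 + _ + _; set A := 1 + _ + _ => PA.
have -> : (b - a * complex.Re z + a * (r + eta)) * L n =
  (b - a * complex.Re z) * L n + (r * (a * L n) + eta * (a * L n)) by ring.
rewrite !expRD [leRHS](_ : _ = expR ((b - a * complex.Re z) * L n) *
  (A * expR (eta * (a * L n)) * expR (r * (a * L n)))); last by ring.
by rewrite ler_pM2l ?expR_gt0 // ler_pM2r ?expR_gt0.
Qed.

End Domination.

(** * The Euler product of zeta *)

(** [n > 0] has no prime factor below [N]. *)
Definition rough (N n : nat) : bool :=
  (0 < n)%N && all (fun q => ~~ (q %| n)%N) [seq q <- iota 0 N | prime q].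

Lemma rough0 n : rough 0 n = (0 < n)%N.
Proof. by rewrite /rough /= andbT. Qed.

Lemma roughS N n : rough N.+1 n = rough N n && (prime N ==> ~~ (N %| n)%N).
Proof.
rewrite /rough -[in iota 0 N.+1]addn1 iotaD filter_cat all_cat /= add0n -andbA.
by case: (prime N) => //=; rewrite andbT.
Qed.

Lemma roughM p m : prime p -> rough p (p * m) = rough p m.
Proof.
move=> pp; rewrite /rough muln_gt0 prime_gt0 //=; congr (_ && _).
apply: eq_in_all => q; rewrite mem_filter mem_iota => /andP[qp /andP[_ qlt]].
rewrite Euclid_dvdM // dvdn_prime2 //.
by case: eqP qlt => [->|//]; rewrite add0n ltnn.
Qed.

Lemma rough_small N n : (1 < n < N)%N -> rough N n = false.
Proof.
move=> /andP[n1 nN]; apply/negbTE; rewrite negb_and; apply/orP; right.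
apply/allPn; exists (pdiv n); last by rewrite negbK pdiv_dvd.
rewrite mem_filter pdiv_prime // mem_iota /= add0n.
by rewrite (leq_ltn_trans _ nN) // pdiv_leq // ltnW.
Qed.

Lemma rough1 N : rough N 1.
Proof.
rewrite /rough /=; apply/allP => q; rewrite mem_filter => /andP[qp _].
by rewrite dvdn1; apply: contraL qp => /eqP ->.
Qed.

Lemma sum_multiples (V : zmodType) (G : nat -> V) p M : (0 < p)%N ->
  \sum_(0 <= n < p * M) (if (p %| n)%N then G n else 0) = \sum_(0 <= m < M) G (p * m)%N.
Proof.
move=> p0; elim: M => [|M ih]; first by rewrite muln0 !big_geq.
rewrite mulnS addnC (big_cat_nat (leq0n _) (leq_addr p (p * M))) /= ih big_nat_recr //=.
congr (_ + _); rewrite big_ltn; last by rewrite -[X in (X < _)%N]addn0 ltn_add2l.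
rewrite dvdn_mulr // big_nat_cond big1 ?addr0 // => n /andP[/andP[h1 h2] _].
case: ifP => // /dvdnP [k nk]; move: h1 h2; rewrite nk (mulnC k) ltn_pmul2l // addnC -mulnS.
by rewrite ltn_pmul2l // ltnS => /leq_trans h /h; rewrite ltnn.
Qed.

Section Zeta.
Variable R : realType.
Local Notation C := (Cplx R).
Local Notation L := (@ln_nat R).

Lemma cabs_sub0 (x : C) : cabs (0 - x) = cabs x.
Proof. by rewrite sub0r cabsN. Qed.

Lemma natpowC1 (s : C) : natpowC 1 s = 1.
Proof. by rewrite natpowCE /ln_nat ln1 mulr0 expC0. Qed.

Section EulerProduct.
Variable w : C.
Hypothesis w1 : 1 < complex.Re w.

Let K n : R := expR (- (1 + (complex.Re w - 1)) * L n).

Let bK : sum_bounded K.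
Proof. by apply: p_series_bounded; rewrite subr_gt0. Qed.

Let aK n : cabs (natpowC n (- w) : C) <= K n.
Proof. by rewrite cabs_natpowC /K addrC subrK; case: w. Qed.

Let term N n : C := if rough N n then natpowC n (- w) else 0.

Let termK N n : cabs (term N n) <= K n.
Proof. by rewrite /term; case: ifP => _; [exact: aK | rewrite cabs0 bK.1]. Qed.

(** The sum of [n^-w] over the integers without prime factors below [N]; it is
    [zeta w] for [N = 0], and removing the multiples of a prime [p] multiplies it
    by [1 - p^-w]. *)
Let Z N : C := lim ((fun M => \sum_(0 <= n < M) term N n) @ \oo).

Let cvgZ N : (fun M => \sum_(0 <= n < M) term N n) @ \oo --> Z N.
Proof. by have [l hl] := series_cvg bK (termK N); rewrite /Z (cvg_limC hl). Qed.

Let sum_term0 : (fun N => \sum_(1 <= n < N) natpowC n (- w)) =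
  (fun N => \sum_(0 <= n < N) term 0 n).
Proof.
apply/funext => -[|N]; first by rewrite !big_geq.
rewrite [RHS]big_ltn // /term rough0 /= add0r.
by apply: eq_big_nat => n /andP[n0 _]; rewrite rough0 n0.
Qed.

Lemma cvg_zeta :
  (fun N => \sum_(1 <= n < N) natpowC n (- w)) @ \oo --> zeta w.
Proof. by rewrite /zeta sum_term0; exact: cvgZ. Qed.

Let Z0 : Z 0 = zeta w.
Proof. by rewrite /zeta sum_term0. Qed.

Let ZS N : Z N.+1 = Z N * (if prime N then 1 - natpowC N (- w) else 1).
Proof.
case: ifP => pN; last first.
  rewrite mulr1 /Z (_ : term N.+1 = term N) //.
  by apply/funext => n; rewrite /term roughS pN andbT.
have N0 : (0 < N)%N by rewrite prime_gt0.
have E M : \sum_(0 <= n < N * M) term N.+1 n =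
    \sum_(0 <= n < N * M) term N n - natpowC N (- w) * \sum_(0 <= n < M) term N n.
  have -> : natpowC N (- w) * \sum_(0 <= n < M) term N n =
     \sum_(0 <= n < N * M) (if (N %| n)%N then term N n else 0).
    rewrite sum_multiples // mulr_sumr; apply: eq_bigr => n _.
    rewrite /term roughM //; case: ifP => [|_]; last by rewrite mulr0.
    by move=> /andP[n0 _]; rewrite natpowCM.
  rewrite -sumrB; apply: eq_bigr => n _; rewrite /term roughS pN /=.
  by case: (rough N n); case: (N %| n)%N; rewrite /= ?subrr ?subr0.
have sub (N' : nat) : (fun M => \sum_(0 <= n < N * M) term N' n) @ \oo --> Z N'.
  have mc : (fun M => (N * M)%N) @ \oo --> \oo.
    move=> A [k _ kA]; exists k => // M /= kM; apply: kA => /=.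
    by rewrite (leq_trans kM) // leq_pmull.
  exact: (@cvg_comp _ _ _ (fun M => (N * M)%N)
    (fun M => \sum_(0 <= n < M) term N' n) _ _ _ mc (@cvgZ N')).
have h1 := sub N.+1.
have h2 : (fun M => \sum_(0 <= n < N * M) term N.+1 n) @ \oo --> Z N - natpowC N (- w) * Z N.
  under eq_fun do rewrite E.
  exact: (cvgB (sub N) (cvgM (cvg_cst _) (@cvgZ N))).
by rewrite -(cvg_limC h1) (cvg_limC h2); ring.
Qed.

Let ZE N : Z N = zeta w * \prod_(0 <= p < N | prime p) (1 - natpowC p (- w)).
Proof.
elim: N => [|N ih]; first by rewrite Z0 big_geq // mulr1.
by rewrite ZS ih big_mkcond [in RHS]big_mkcond big_nat_recr //= mulrA.
Qed.

(** Apart from 1, all terms of [Z N] have index at least [N]. *)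
Let Zcvg : Z @ \oo --> (1 : C).
Proof.
apply/cvgCP => e e0.
have [N0 hN0] := sum_bounded_tail bK e0.
exists (maxn 2 N0) => // N /=; rewrite geq_max => /andP[N2 NN0].
have cv : (fun M => 1 - \sum_(0 <= n < M) term N n) @ \oo --> 1 - Z N.
  exact: (cvgB (cvg_cst (1 : C)) (@cvgZ N)).
apply: (cabs_lim_le cv).
exists N => // M /= NM.
have M2 := leq_trans N2 NM.
rewrite /= (big_ltn (ltnW M2)) (big_ltn M2) {1 2}/term rough1 (_ : rough N 0 = false) // natpowC1 add0r.
rewrite opprD addrA subrr add0r cabsN (big_cat_nat N2 NM) /=.
rewrite big_nat_cond big1 => [|n /andP[h _]]; last by rewrite /term rough_small.
rewrite add0r (le_trans (cabs_sum _ _ _)) // (le_trans _ (hN0 N M _)) ?NN0 //.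
by apply: ler_sum => n _; exact: termK.
Qed.

Lemma zeta_neq0 : zeta w != 0.
Proof.
apply/eqP => z0; have := cvg_limC Zcvg.
rewrite (_ : Z = (fun=> 0)); last by apply/funext => N; rewrite ZE z0 mul0r.
rewrite (cvg_limC (cvg_cst (0 : C))) => /eqP.
by rewrite eq_sym oner_eq0.
Qed.

Lemma euler_product :
  (fun N => \prod_(0 <= p < N | prime p) (1 - natpowC p (- w))) @ \oo --> (zeta w)^-1.
Proof.
have -> : (fun N => \prod_(0 <= p < N | prime p) (1 - natpowC p (- w))) =
   (fun N => (zeta w)^-1 * Z N).
  by apply/funext => N; rewrite ZE mulKf // zeta_neq0.
rewrite -[X in _ --> X]mulr1; exact: (cvgM (cvg_cst _) Zcvg).
Qed.

End EulerProduct.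

(** * Continuation of zeta *)

(** [zeta_term n s] is [(s-2) n^(1-s)] minus the integral of [(s-2) x^(1-s)]
    over [[n, n+1]]. *)
Definition zeta_term (n : nat) (s : C) : C :=
  if n is 0 then 0 else
  (s - 2) * natpowC n (1 - s) - (natpowC n (2 - s) - natpowC n.+1 (2 - s)).

(** The analytic continuation of [(s - 2) zeta(s - 1)]. *)
Definition zeta_reg (s : C) : C := 1 + infsum zeta_term s.

Lemma zeta_reg2 : zeta_reg 2 = 1.
Proof.
rewrite /zeta_reg /infsum (_ : (fun N => _) = (fun=> 0)) ?(cvg_limC (cvg_cst (0 : C))) ?addr0 //.
apply/funext => N; rewrite big1 // => -[|n] _ //.
by rewrite /zeta_term !subrr !natpowC0 subrr mul0r subrr.
Qed.

(** With [l = ln (n+1) - ln n], the [n]-th term is [n^(2-s)] times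
    [(s-2) (1/n - l) + (e^x - 1 - x)] for [x = - l (s-2)]; both summands are of
    order [n^-2]. *)
Lemma zeta_reg_jets (z : C) : 2 - 32^-1 < complex.Re z ->
  exists K, sum_bounded K /\ forall n, jet z 32^-1 (zeta_term n) (K n).
Proof.
move=> hz.
have r0 : 0 < 32^-1 :> R by rewrite invr_gt0.
have r1 : 32^-1 <= 1 :> R by rewrite invf_le1 // ler1n.
pose v := cabs (z - 2); have v0 : 0 <= v by exact: cabs_ge0.
pose Bv : R := 4 * v ^+ 2 * expR v + 5 * v * expR (2 * v) + 4 * expR v * expR 1.
pose A0 : R := 1 + (32^-1)^-1 + 16 * (32^-1)^-1 ^+ 2.
have J n : (1 <= n)%N -> jet z 32^-1 (zeta_term n)
    (A0 * (cabs z + 1 + cabs (- 2 : C) + Bv) * expR (- (1 + 8^-1) * L n)).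
  move=> n1; have n0 : 0 < n%:R :> R by rewrite ltr0n.
  pose l : R := L n.+1 - L n.
  have i1 : (n%:R)^-1 <= 1 :> R by rewrite invf_le1 // ler1n.
  have i0 : 0 < (n%:R)^-1 :> R by rewrite invr_gt0.
  have j0 : 0 < (n.+1%:R)^-1 :> R by rewrite invr_gt0 ltr0n.
  have l1 : (n.+1%:R)^-1 <= l by have := ln_nat_succ_ge R n1; rewrite /l lerBrDl.
  have l2 : l <= (n%:R)^-1 by have := ln_nat_succ_le R n1; rewrite /l lerBlDl.
  have l0 : 0 <= l by rewrite (le_trans (ltW j0)).
  have lle1 : l <= 1 by rewrite (le_trans l2).
  have l3 : l ^+ 2 <= (n%:R)^-1 ^+ 2 by rewrite ler_sqr // nnegrE ltW.
  pose dl : R := (n%:R)^-1 - l.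
  have dl0 : 0 <= dl by rewrite subr_ge0.
  have dl1 : dl <= (n%:R)^-1 ^+ 2.
    apply: (@le_trans _ _ ((n%:R)^-1 - (n.+1%:R)^-1)); first by rewrite lerB.
    have -> : (n%:R)^-1 - (n.+1%:R)^-1 = (n%:R)^-1 * (n.+1%:R)^-1 :> R.
      by rewrite -natr1; field; rewrite natr1 !lt0r_neq0 // ltr0n.
    by rewrite expr2 ler_pM2l // lef_pV2 ?posrE ?ltr0n // ler_nat.
  pose lC : C := Complex l 0; pose dC : C := Complex dl 0.
  have E s : zeta_term n s = natpowC n (Complex 2 0 - Complex 1 0 * s) *
      (dC * (s + - 2) + (expC (lC * 2 + - lC * s) - 1 - (lC * 2 + - lC * s))).
    have cinv : ((n%:R)^-1 : C) = dC + lC.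
      rewrite /dC /lC -(rmorph_nat (real_complex R)) -fmorphV.
      by apply/eqP; rewrite eq_complex /= addr0 eqxx andbT /dl subrK.
    have nS : natpowC n.+1 (2 - s) = natpowC n (2 - s) * expC ((2 - s) * lC).
      rewrite !natpowCE -expCD -mulrDr; congr (expC (_ * _)).
      by apply/eqP; rewrite eq_complex /= addr0 eqxx andbT /l addrC subrK.
    have n1s : natpowC n (1 - s) = natpowC n (2 - s) * (dC + lC).
      rewrite (_ : 1 - s = (2 - s) + - 1%:R); last by ring.
      by rewrite natpowCD natpowCN natpowC_nat // expr1 cinv.
    have -> : Complex 2 0 - Complex 1 0 * s = 2 - s.
      rewrite -[Complex 1 0]/(1 : C) mul1r; congr (_ - _).
      exact: (rmorph_nat (real_complex R) 2).
    rewrite (_ : lC * 2 + - lC * s = (2 - s) * lC); last by ring.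
    have -> : zeta_term n s =
        (s - 2) * natpowC n (1 - s) - (natpowC n (2 - s) - natpowC n.+1 (2 - s)).
      by move: n1; case: (n).
    by rewrite nS n1s; ring.
  have lCE : cabs (- lC) = l by rewrite cabsN cabs_real ger0_norm.
  have jE : jet z 32^-1 (fun s => expC (lC * 2 + - lC * s) - 1 - (lC * 2 + - lC * s)) (l ^+ 2 * Bv).
    set x := lC * 2 + - lC * z.
    have xE : cabs x = l * v.
      by rewrite /x (_ : _ + _ = - lC * (z - 2)) ?cabsM ?lCE //; ring.
    have lv0 : 0 <= l * v by rewrite mulr_ge0.
    have lv : l * v <= v by rewrite ler_piMl.
    have ex : cabs (expC x) <= expR v.
      rewrite cabs_expC ler_expR (le_trans (ler_norm _)) // (le_trans (Re_le_cabs _)) //.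
      by rewrite xE.
    (* the derivative of [s |-> e^x - 1 - x], where [x = - l (s-2)] *)
    exists (- lC * (expC x - 1)), (expR v * (4 * l ^+ 2 * expR 1)); split.
    - by rewrite !mulr_ge0 ?expR_ge0 ?sqr_ge0.
    - rewrite cabsM lCE.
      have h1 := cabs_expC_B1Dz x; have h2 := cabs_expCB1 x; rewrite xE in h1 h2.
      have h3 : cabs (expC x - 1 - x) <= 4 * (l * v) ^+ 2 * expR v.
        rewrite (le_trans h1) // ler_wpM2l ?ler_expR //.
        by rewrite mulr_ge0 // sqr_ge0.
      have h4 : cabs (expC x - 1) <= 5 * (l * v) * expR (2 * v).
        rewrite (le_trans h2) // ler_wpM2l ?ler_expR //; first by rewrite mulr_ge0.
        by rewrite ler_pM2l.
      have h5 := ler_wpM2l l0 h4.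
      rewrite (le_trans (lerD (lerD h3 h5) (lexx _))) // le_eqVlt; apply/orP; left; apply/eqP.
      by rewrite /Bv; ring.
    move=> h hr; pose k := - lC * h.
    have kE : cabs k = l * cabs h by rewrite cabsM lCE.
    have -> : expC (lC * 2 + - lC * (z + h)) - 1 - (lC * 2 + - lC * (z + h)) -
        (expC x - 1 - x) - - lC * (expC x - 1) * h = expC x * (expC k - 1 - k).
      rewrite (_ : lC * 2 + - lC * (z + h) = x + k); last by rewrite /x /k; ring.
      by rewrite expCD /k; ring.
    rewrite cabsM -!mulrA; apply: ler_pM; rewrite ?cabs_ge0 //.
    rewrite (le_trans (cabs_expC_B1Dz _)) // kE.
    have h1 : cabs h <= 1 by rewrite (le_trans hr).
    have h0 := cabs_ge0 h.
    rewrite [leRHS](_ : _ = 4 * (l * cabs h) ^+ 2 * expR 1); last by ring.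
    apply: ler_wpM2l; first by rewrite mulr_ge0 // sqr_ge0.
    by rewrite ler_expR mulr_ile1.
  have jl : jet z 32^-1 (fun s => dC * (s + - 2)) (dl * (cabs z + 1 + cabs (- 2 : C))).
    have dCE : cabs dC = dl by rewrite cabs_real ger0_norm.
    rewrite -dCE; apply: jetM => //; first exact: jet_cst.
    by apply: jetD => //; [exact: jet_id | exact: jet_cst].
  have jp := jet_natpowC z n 2 r0 r1 r0 (@ler01 R).
  have := jetM r1 jp (jetD jl jE).
  rewrite (_ : (fun s => _) = zeta_term n); last by apply/funext => s; rewrite E.
  apply: jet_le.
  have L0 := ln_nat_ge0 R n.
  have A00 : 0 <= A0 by rewrite /A0 !addr_ge0 // ?mulr_ge0 ?sqr_ge0.
  have B0 : 0 <= Bv.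
    by rewrite /Bv !addr_ge0 // ?mulr_ge0 ?sqr_ge0 ?expR_ge0 // mulr_ge0 ?expR_ge0.
  have X0 : 0 <= cabs z + 1 + cabs (- 2 : C) by rewrite !addr_ge0 ?cabs_ge0.
  have n2 : (n%:R)^-1 ^+ 2 = expR (- 2 * L n) :> R.
    rewrite -(expR_ln_nat R n1) -expRN -expRM_natl; congr expR; ring.
  have k1 : dl * (cabs z + 1 + cabs (- 2 : C)) + l ^+ 2 * Bv <=
     (n%:R)^-1 ^+ 2 * (cabs z + 1 + cabs (- 2 : C) + Bv).
    by rewrite [leRHS]mulrDr lerD // ler_wpM2r.
  rewrite (le_trans (ler_wpM2l _ k1)) ?mulr_ge0 ?expR_ge0 // n2.
  rewrite -/A0 [leLHS](_ : _ = A0 * (cabs z + 1 + cabs (- 2 : C) + Bv) *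
     (expR ((2 - 1 * complex.Re z + 1 * (32^-1 + 32^-1)) * L n) * expR (- 2 * L n))); last by ring.
  apply: ler_wpM2l; first by rewrite mulr_ge0 // addr_ge0.
  rewrite -expRD ler_expR -mulrDl.
  by rewrite ler_wpM2r //; lra.
have e8 : 0 < 8^-1 :> R by rewrite invr_gt0.
apply: (dominated_jets e8 _ J) => -[|n]; first by exists (cabs (0 : C)); exact: jet_cst.
by eexists; exact: J.
Qed.

Lemma derivable_zeta_reg (z : C) : 2 - 32^-1 < complex.Re z ->
  derivable (zeta_reg : C^o -> C^o) z 1.
Proof.
move=> hz; have [K [bK jK]] := zeta_reg_jets hz.
apply: derivableD; first exact: derivable_cst.
apply: (derivable_infsum _ _ bK jK); first by rewrite invr_gt0.
by rewrite invf_le1 // ler1n.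
Qed.

(** The subtracted terms [n^(2-s) - (n+1)^(2-s)] telescope to 1. *)
Lemma zeta_regE (s : C) : 2 < complex.Re s -> zeta_reg s = (s - 2) * zeta (s - 1).
Proof.
move=> hs.
have s1 : 1 < complex.Re (s - 1) by case: s hs => a b /= hs; lra.
have r0 : 0 < 32^-1 :> R by rewrite invr_gt0.
have r1 : 32^-1 <= 1 :> R by rewrite invf_le1 // ler1n.
have [K [bK jK]] : exists K, sum_bounded K /\ forall n, jet s 32^-1 (zeta_term n) (K n).
  by apply: zeta_reg_jets; lra.
have := @cvg_infsum _ s 32^-1 _ _ r1 bK jK 0; rewrite cabs0 addr0 => /(_ (ltW r0)) c1.
have c2 := cvg_zeta s1.
have c3 : (fun N => natpowC N (2 - s)) @ \oo --> (0 : C).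
  apply/cvgCP => e e0.
  pose c := complex.Re s - 2; have c0 : 0 < c by rewrite subr_gt0.
  pose M := - ln e / c.
  have [N hN] : exists N : nat, expR M <= N%:R :> R.
    by exists (Num.truncn (expR M)).+1; rewrite ltW // truncnS_gt.
  exists N => // n Nn; have {}Nn : (N <= n)%N by exact: Nn.
  have -> : cabs (0 - natpowC n (2 - s)) = expR (- c * L n).
    rewrite cabs_sub0 cabs_natpowC (_ : complex.Re (2 - s) = - c) //.
    by rewrite /c; case: (s) => a b /=; rewrite opprB.
  have Mn : expR M <= n%:R by rewrite (le_trans hN) // ler_nat.
  have n0 : (0 < n)%N by rewrite -(ltr0n R) (lt_le_trans (expR_gt0 M)).
  have ML : M <= L n by rewrite -ler_expR expR_ln_nat.
  rewrite -[leRHS]lnK ?posrE // ler_expR.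
  have := ler_wpM2l (ltW c0) ML; rewrite /M mulrC divfK ?lt0r_neq0 //; lra.
have E N : (0 < N)%N -> 1 + \sum_(0 <= n < N) zeta_term n s =
   (s - 2) * \sum_(1 <= n < N) natpowC n (- (s - 1)) + natpowC N (2 - s).
  case: N => // N _; elim: N => [|N ih].
    by rewrite big_nat_recr // !big_geq //= natpowC1 !addr0 mulr0 add0r.
  rewrite big_nat_recr //= [in RHS]big_nat_recr //= addrA ih mulrDr.
  by rewrite opprB; ring.
have k1 : (fun N => 1 + \sum_(0 <= n < N) zeta_term n s) @ \oo --> zeta_reg s.
  exact: (cvgD (cvg_cst (1 : C)) c1).
have k2 : (fun N => (s - 2) * \sum_(1 <= n < N) natpowC n (- (s - 1)) + natpowC N (2 - s))
   @ \oo --> (s - 2) * zeta (s - 1).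
  by rewrite -[X in _ --> X]addr0; exact: (cvgD (cvgM (cvg_cst (s - 2)) c2) c3).
have k3 : {near \oo,
    (fun N => (s - 2) * \sum_(1 <= n < N) natpowC n (- (s - 1)) + natpowC N (2 - s)) =1
    (fun N => 1 + \sum_(0 <= n < N) zeta_term n s)}.
  by exists 1%N => // N N0; rewrite (E N).
have k4 := cvg_trans (near_eq_cvg k3) k2.
by rewrite -(cvg_limC k1) (cvg_limC (k4 _)).
Qed.

End Zeta.

(** * The local factors of the generating function *)

Section EulerFactors.
Variables (R : realType) (E : weierstrass rat).
Hypothesis hE : is_elliptic_curve E.
Local Notation C := (Cplx R).
Local Notation L := (@ln_nat R).
Local Notation t p := ((frob_trace E p)%:~R : C).

Lemma goodE p : good E p = ~~ bad E p. Proof. by []. Qed.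

Lemma nat2C : (2 : C) = Complex 2 0.
Proof. exact/esym/(rmorph_nat (real_complex R) 2). Qed.

Lemma affine12 (s : C) : 1 - 2 * s = Complex 1 0 - Complex 2 0 * s.
Proof. by rewrite nat2C. Qed.

Lemma affine11 (s : C) : 1 - s = Complex 1 0 - Complex 1 0 * s.
Proof. by rewrite -[Complex 1 0]/(1 : C) mul1r. Qed.

Lemma affine01 (s : C) : - s = Complex 0 0 - Complex 1 0 * s.
Proof. by rewrite -[Complex 1 0]/(1 : C) mul1r -[Complex 0 0]/(0 : C) sub0r. Qed.

Lemma cabs_natpowC_affine n (b a : R) (s : C) :
  cabs (natpowC n (Complex b 0 - Complex a 0 * s)) = expR ((b - a * complex.Re s) * L n).
Proof. by rewrite cabs_natpowC; case: s => x y /=; rewrite mul0r subr0. Qed.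

Lemma neq0_1D (x : C) : cabs x < 1 -> 1 + x != 0.
Proof.
move=> x1; apply/eqP => h; have := cabsB_ge 1 x.
by rewrite h cabs0 cabs1; lra.
Qed.

Lemma ln_prime_gt0 p : prime p -> 0 < L p.
Proof. by move=> pp; rewrite ln_gt0 // ltr1n prime_gt1. Qed.

Lemma expRN_ln_prime p : prime p -> expR (- L p) <= 2^-1.
Proof.
move=> pp; rewrite expRN expR_ln_nat ?prime_gt0 // lef_pV2 ?posrE ?ltr0n ?prime_gt0 //.
by rewrite ler_nat prime_gt1.
Qed.

Lemma cabs_natpowC_lt1 p (b a : R) (s : C) : prime p -> b - a * complex.Re s < 0 ->
  cabs (natpowC p (Complex b 0 - Complex a 0 * s)) < 1.
Proof.
move=> pp h; rewrite cabs_natpowC_affine expR_lt1 pmulr_llt0 // ln_prime_gt0 //.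
Qed.

(** The factor of [N(s)] at [p], minus 1. *)
Definition num_factor (p : nat) (s : C) : C :=
  if prime p then - natpowC p (if good E p then 1 - 2 * s else 1 - s) else 0.

(** The factor of [D(s)] at [p], minus 1. *)
Definition den_factor (p : nat) (s : C) : C :=
  if prime p && good E p then - (t p * natpowC p (- s)) + natpowC p (1 - 2 * s) else 0.

Lemma cabs_trace_le p : prime p -> cabs (t p) <= p%:R.
Proof.
move=> pp; rewrite cabs_int.
by have := frob_trace_le E pp; rewrite -(ler_int R).
Qed.

Lemma cabs_trace_bound p : prime p -> (3 < p)%N -> good E p ->
  cabs (t p) <= 4 * expR (3 / 4 * L p).
Proof.
move=> pp p3 gp; rewrite cabs_int -(ler_pXn2r (isT : (0 < 4)%N)) ?nnegrE ?ler0z ?mulr_ge0 ?expR_ge0 //.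
have := frob_trace_bound pp p3 gp; rewrite -(ler_int R) [leLHS]rmorphXn [leRHS]rmorphM [X in _ * X]rmorphXn /= => h.
rewrite exprMn -expRM_natl (_ : 4%:R * (3 / 4 * L p) = 3%:R * L p); last by field.
rewrite expRM_natl expR_ln_nat ?prime_gt0 //.
rewrite intr_norm -normrX ger0_norm; last by rewrite -[4%N]/(2 * 2)%N exprM sqr_ge0.
rewrite (le_trans h) //.
have : 0 <= (p%:R : R) ^+ 3 by rewrite exprn_ge0.
by rewrite -[(p%:Z)%:~R]/(p%:R : R) => h0; rewrite ler_wpM2r //; lra.
Qed.

(* [eps] is at once the radius of the discs, the margin to the left of 2 and the
   exponent that absorbs powers of the logarithm. *)
Let eps : R := 32^-1.
Let eps0 : 0 < eps. Proof. by rewrite invr_gt0. Qed.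
Let eps1 : eps <= 1. Proof. by rewrite invf_le1 // ler1n. Qed.
Let A0 : R := 1 + eps^-1 + 16 * eps^-1 ^+ 2.
Let A00 : 0 <= A0.
Proof. by rewrite /A0 !addr_ge0 ?mulr_ge0 ?sqr_ge0 // invr_ge0 ltW. Qed.

Lemma jet0 (z : C) (r K : R) : 0 <= K -> jet z r (fun=> 0 : C) K.
Proof. by move=> K0; apply: jet_le (jet_cst z r 0); rewrite cabs0. Qed.

Section Jets.
Variable z : C.
Hypothesis hz : 2 - eps < complex.Re z.

Lemma jet_natpowC_1B2s n : jet z eps (fun s => natpowC n (1 - 2 * s))
  (A0 * expR ((1 - 2 * complex.Re z + 2 * (eps + eps)) * L n)).
Proof.
rewrite (_ : (fun s => _) = (fun s => natpowC n (Complex 1 0 - Complex 2 0 * s))).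
  exact: jet_natpowC.
by apply/funext => s; rewrite affine12.
Qed.

Lemma jet_natpowC_1Bs n : jet z eps (fun s => natpowC n (1 - s))
  (A0 * expR ((1 - 1 * complex.Re z + 1 * (eps + eps)) * L n)).
Proof.
rewrite (_ : (fun s => _) = (fun s => natpowC n (Complex 1 0 - Complex 1 0 * s))).
  exact: jet_natpowC.
by apply/funext => s; rewrite affine11.
Qed.

Lemma jet_natpowC_Ns n : jet z eps (fun s => natpowC n (- s))
  (A0 * expR ((0 - 1 * complex.Re z + 1 * (eps + eps)) * L n)).
Proof.
rewrite (_ : (fun s => _) = (fun s => natpowC n (Complex 0 0 - Complex 1 0 * s))).
  exact: jet_natpowC.
by apply/funext => s; rewrite affine01.
Qed.

Let e8 : 0 < 8^-1 :> R. Proof. by rewrite invr_gt0. Qed.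

(** At the good primes the exponent [1 - 2s] has real part below -2; the finitely
    many bad primes do not matter. *)
Lemma num_factor_jets : exists K, sum_bounded K /\ forall n, jet z eps (num_factor n) (K n).
Proof.
have [Nb hNb] := bad_finite hE.
apply: (@dominated_jets R z eps num_factor A0 8^-1 Nb e8) => n.
  rewrite /num_factor; case: (prime n); last by exists 0; exact: jet0.
  by case: (good E n); [eexists; exact: (jetN (jet_natpowC_1B2s n)) | eexists; exact: (jetN (jet_natpowC_1Bs n))].
move=> nN; rewrite /num_factor; case np: (prime n); last by apply: jet0; rewrite mulr_ge0 ?expR_ge0.
rewrite goodE hNb //; apply: jetN; apply: jet_le (jet_natpowC_1B2s n).
rewrite ler_wpM2l // ler_expR ler_wpM2r ?ln_nat_ge0 //.
by move: hz; rewrite /eps => hz'; lra.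
Qed.

(** Here the saving in [t_p] is used: [t_p p^(-s)] is of order at most
    [p^(3/4 - Re s)], with exponent below -1. *)
Lemma den_factor_jets : exists K, sum_bounded K /\ forall n, jet z eps (den_factor n) (K n).
Proof.
have jt n k : cabs (t n) <= k -> jet z eps (fun s => - (t n * natpowC n (- s)) + natpowC n (1 - 2 * s))
   (k * (A0 * expR ((0 - 1 * complex.Re z + 1 * (eps + eps)) * L n)) +
    A0 * expR ((1 - 2 * complex.Re z + 2 * (eps + eps)) * L n)).
  move=> tk; apply: jetD (jet_natpowC_1B2s n); apply: jetN; apply: jetM (jet_natpowC_Ns n) => //.
  exact: jet_le tk (jet_cst z eps (t n)).
apply: (@dominated_jets R z eps den_factor (4 * A0 + A0) 8^-1 5 e8) => n.
  rewrite /den_factor; case: (prime n && good E n); last by exists 0; exact: jet0.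
  by eexists; apply: jt; exact: lexx.
move=> n5; rewrite /den_factor; case: (boolP (prime n && good E n)) => [/andP[np ng]|_]; last first.
  by apply: jet0; rewrite mulr_ge0 ?expR_ge0 // addr_ge0 // mulr_ge0.
apply: jet_le (jt n _ (cabs_trace_bound np _ ng)); last by apply: leq_trans n5.
have L0 := ln_nat_ge0 R n.
have h1 : expR (3 / 4 * L n) * expR ((0 - 1 * complex.Re z + 1 * (eps + eps)) * L n)
   <= expR (- (1 + 8^-1) * L n).
  rewrite -expRD ler_expR -mulrDl ler_wpM2r //.
  by move: hz; rewrite /eps => hz'; lra.
have h2 : expR ((1 - 2 * complex.Re z + 2 * (eps + eps)) * L n) <= expR (- (1 + 8^-1) * L n).
  rewrite ler_expR ler_wpM2r //.
  by move: hz; rewrite /eps => hz'; lra.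
have h3 := ler_wpM2l A00 h1; have h4 := ler_wpM2l A00 h2.
rewrite [leRHS]mulrDl; apply: lerD => //.
rewrite [leLHS](_ : _ = 4 * (A0 * (expR (3 / 4 * L n) *
  expR ((0 - 1 * complex.Re z + 1 * (eps + eps)) * L n)))); last by ring.
by rewrite -[leRHS]mulrA ler_wpM2l.
Qed.

Lemma num_factor_neq0 n : 1 + num_factor n z != 0.
Proof.
apply: neq0_1D; rewrite /num_factor; case: ifP => np; last by rewrite cabs0.
have h2 : 1 - 2 * complex.Re z < 0 by move: hz; rewrite /eps => hz'; lra.
have h1 : 1 - 1 * complex.Re z < 0 by move: hz; rewrite /eps => hz'; lra.
rewrite cabsN; case: (good E n).
  by rewrite (affine12 z); exact: (cabs_natpowC_lt1 np h2).
by rewrite (affine11 z); exact: (cabs_natpowC_lt1 np h1).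
Qed.

(** With [x = p^(-1/2)], the factor differs from 1 by at most [x + x^5], which is
    less than 1 already for [p = 2]. *)
Lemma den_factor_neq0 n : 1 + den_factor n z != 0.
Proof.
apply: neq0_1D; rewrite /den_factor; case: ifP => [/andP[np ng]|_]; last by rewrite cabs0.
rewrite (affine12 z) (affine01 z) (le_lt_trans (cabsD _ _)) // cabsN cabsM !cabs_natpowC_affine.
have L0 := ln_prime_gt0 np.
pose x := expR (- (L n / 2)).
have x0 : 0 < x by exact: expR_gt0.
have x2 : x ^+ 2 <= 2^-1.
  rewrite -expRM_natl (_ : 2%:R * - (L n / 2) = - L n) ?expRN_ln_prime //.
  by field.
have h1 : cabs (t n) * expR ((0 - 1 * complex.Re z) * L n) <= x.
  apply: (@le_trans _ _ (n%:R * expR ((0 - 1 * complex.Re z) * L n))).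
    by rewrite ler_wpM2r ?expR_ge0 // cabs_trace_le.
  rewrite -(expR_ln_nat R (prime_gt0 np)) -expRD ler_expR.
  have hz' : 0 <= complex.Re z - 3 / 2 by have := hz; rewrite /eps; lra.
  have := mulr_ge0 hz' (ltW L0); lra.
have h2 : expR ((1 - 2 * complex.Re z) * L n) <= x * (x ^+ 2) ^+ 2.
  rewrite /x -!expRM_natl -expRD ler_expR.
  have hz' : 0 <= 2 * complex.Re z - 7 / 2 by have := hz; rewrite /eps; lra.
  have := mulr_ge0 hz' (ltW L0); lra.
have x3 : (x ^+ 2) ^+ 2 <= 4^-1.
  rewrite (_ : 4^-1 = (2^-1) ^+ 2); last by field.
  by rewrite ler_sqr ?nnegrE ?sqr_ge0.
have x5 : x * (x ^+ 2) ^+ 2 <= x * 4^-1 by rewrite ler_pM2l.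
apply: (@le_lt_trans _ _ (x + x * 4^-1)); first by apply: lerD => //; apply: le_trans x5.
by nra.
Qed.

End Jets.
End EulerFactors.

(** * The continued generating function *)

Section Continuation.
Variables (R : realType) (E : weierstrass rat).
Hypothesis hE : is_elliptic_curve E.
Local Notation C := (Cplx R).
Local Notation num_factor := (@num_factor R E).
Local Notation den_factor := (@den_factor R E).
(* [N(s)] and [D(s)] *)
Local Notation P1 := (infprod num_factor).
Local Notation P2 := (infprod den_factor).

Lemma prime_product_lim (P : pred nat) (f : nat -> C) (l : C) :
  (fun N => \prod_(0 <= p < N | prime p && P p) f p) @ \oo --> l ->
  prime_product P f = l.
Proof. exact: cvg_limC. Qed.

Lemma inv32_gt0 : 0 < 32^-1 :> R. Proof. by rewrite invr_gt0. Qed.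
Lemma inv32_le1 : 32^-1 <= 1 :> R. Proof. by rewrite invf_le1 // ler1n. Qed.

Section AtPoint.
Variable z : C.
Hypothesis hz : 2 - 32^-1 < complex.Re z.

Lemma cvg_P1 : (fun N => \prod_(0 <= n < N) (1 + num_factor n z)) @ \oo --> P1 z.
Proof.
have [K [bK jK]] := num_factor_jets hE hz.
by have := @cvg_infprod _ z _ _ _ inv32_le1 bK jK 0; rewrite cabs0 addr0 => /(_ (ltW inv32_gt0)).
Qed.

Lemma cvg_P2 : (fun N => \prod_(0 <= n < N) (1 + den_factor n z)) @ \oo --> P2 z.
Proof.
have [K [bK jK]] := den_factor_jets E hz.
by have := @cvg_infprod _ z _ _ _ inv32_le1 bK jK 0; rewrite cabs0 addr0 => /(_ (ltW inv32_gt0)).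
Qed.

Lemma P1_neq0 : P1 z != 0.
Proof.
have [K [bK jK]] := num_factor_jets hE hz.
exact: (infprod_neq0 inv32_gt0 inv32_le1 bK jK (num_factor_neq0 E hz)).
Qed.

Lemma P2_neq0 : P2 z != 0.
Proof.
have [K [bK jK]] := den_factor_jets E hz.
exact: (infprod_neq0 inv32_gt0 inv32_le1 bK jK (den_factor_neq0 E hz)).
Qed.

Lemma derivable_P1 : derivable (P1 : C^o -> C^o) z 1.
Proof.
have [K [bK jK]] := num_factor_jets hE hz.
exact: (derivable_infprod inv32_gt0 inv32_le1 bK jK).
Qed.

Lemma derivable_P2 : derivable (P2 : C^o -> C^o) z 1.
Proof.
have [K [bK jK]] := den_factor_jets E hz.
exact: (derivable_infprod inv32_gt0 inv32_le1 bK jK).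
Qed.

End AtPoint.

(** The holomorphic continuation of [(s - 2) B(s)]. *)
Definition B_reg (s : C) : C := zeta_reg s * (P1 s / P2 s).

Lemma derivable_B_reg (z : C) : 2 - 32^-1 < complex.Re z ->
  derivable (B_reg : C^o -> C^o) z 1.
Proof.
move=> hz; have dV := derivableV (P2_neq0 hz) (derivable_P2 hz).
exact: (derivableM (derivable_zeta_reg hz) (derivableM (derivable_P1 hz) dV)).
Qed.

Lemma prod_mkfactor (P : pred nat) (f g : nat -> C) N :
  (forall p, (if P p then f p else 1) = g p) ->
  \prod_(0 <= p < N | P p) f p = \prod_(0 <= p < N) g p.
Proof. by move=> h; rewrite big_mkcond; apply: eq_bigr => p _; exact: h. Qed.

Lemma one_sub_natpow_neq0 p (s : C) : prime p -> 1 < complex.Re s ->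
  1 - natpowC p (1 - s) != 0.
Proof.
move=> pp hs; apply: neq0_1D; rewrite cabsN affine11.
by apply: cabs_natpowC_lt1 => //; rewrite mul1r subr_lt0.
Qed.

Lemma ell_B_eq (s : C) : 2 < complex.Re s -> ell_B E s = B_reg s / (s - 2).
Proof.
move=> hs.
have hz : 2 - 32^-1 < complex.Re s by have := inv32_gt0; lra.
have s1 : 1 < complex.Re s by lra.
have hs1 : 1 < complex.Re (s - 1) by case: (s) hs => a b /=; lra.
have s2 : s - 2 != 0.
  apply/eqP => h; have : complex.Re (s - 2) = 0 by rewrite h.
  by case: (s) hs => a b /= ha; lra.
have cz : (fun N => \prod_(0 <= p < N | prime p) (1 - natpowC p (1 - s))) @ \oo
    --> (zeta (s - 1))^-1.
  have := euler_product hs1; rewrite (_ : - (s - 1) = 1 - s) //; ring.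
have z0 := zeta_neq0 hs1.
rewrite /B_reg zeta_regE // (_ : _ / (s - 2) = P1 s * (P2 s)^-1 * (zeta (s - 1))^-1^-1); last first.
  by rewrite invrK; field; rewrite P2_neq0.
apply: prime_product_lim.
have h : (fun N => \prod_(0 <= p < N | prime p && good E p)
   ((1 - (frob_trace E p)%:~R * natpowC p (- s) + natpowC p (1 - 2 * s))^-1 *
     ((1 - natpowC p (1 - 2 * s)) / (1 - natpowC p (1 - s))))) =
  (fun N => \prod_(0 <= n < N) (1 + num_factor n s) *
     (\prod_(0 <= n < N) (1 + den_factor n s))^-1 *
     (\prod_(0 <= p < N | prime p) (1 - natpowC p (1 - s)))^-1).
  apply/funext => N; rewrite (big_mkcond prime) /= -!prodfV -!big_split /=.
  apply: prod_mkfactor => p; rewrite /num_factor /den_factor.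
  have n0 pp := @one_sub_natpow_neq0 p s pp s1.
  case: (prime p) n0 => n0; cbv iota delta [andb]; last by rewrite !addr0 invr1 !mulr1.
  case: (good E p); cbv iota.
    by rewrite addrA mulrA [X in X / _]mulrC.
  by rewrite addr0 invr1 mulr1 divff // n0.
rewrite h; apply: cvgM; last by apply: cvgV cz; rewrite invr_eq0.
by apply: cvgM; [exact: cvg_P1 | apply: cvgV; [exact: P2_neq0 | exact: cvg_P2]].
Qed.

Lemma Re_nat (n : nat) : complex.Re (n%:R : C) = n%:R.
Proof. by rewrite -(rmorph_nat (real_complex R)). Qed.

Lemma natpowCN_nat p k : (0 < p)%N -> natpowC p (- k%:R : C) = (p%:R ^+ k)^-1.
Proof. by move=> p0; rewrite natpowCN natpowC_nat. Qed.

Lemma prime_product_ext (P : pred nat) (f g : nat -> C) :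
  (forall p, prime p -> P p -> f p = g p) -> prime_product P f = prime_product P g.
Proof.
move=> h; rewrite /prime_product (_ : (fun N => _) =
  (fun N => \prod_(0 <= p < N | prime p && P p) g p)) //.
by apply/funext => N; apply: eq_bigr => p /andP[pp Pp]; exact: h.
Qed.

(** Applied with [c = -1] and [c = 1] to the split and nonsplit primes, this allows
    these products to be cancelled from the residue. *)
Lemma prime_quadratic_product (P : pred nat) (c : C) : cabs c = 1 ->
  prime_product P (fun p => 1 + c * (p%:R ^+ 2)^-1) != 0.
Proof.
move=> c1; pose u n : C := if prime n && P n then c * (n%:R ^+ 2)^-1 else 0.
have uE N : \prod_(0 <= p < N | prime p && P p) (1 + c * (p%:R ^+ 2)^-1)
    = \prod_(0 <= p < N) (1 + u p).
  by apply: prod_mkfactor => p; rewrite /u; case: ifP => // _; rewrite addr0.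
have bK := @p_series_bounded R 1 ltr01.
have uK n : cabs (u n) <= expR (- (1 + 1) * ln_nat R n).
  rewrite /u; case: ifP => [/andP[pn _]|_]; last by rewrite cabs0 expR_ge0.
  rewrite cabsM c1 mul1r cabsV cabsX cabs_nat -(expR_ln_nat R (prime_gt0 pn)).
  rewrite -expRM_natl -expRN ler_expR; lra.
have u0 n : 1 + u n != 0.
  rewrite /u; case: ifP => [/andP[pn _]|_]; last by rewrite addr0 oner_neq0.
  apply: neq0_1D; rewrite cabsM c1 mul1r cabsV cabsX cabs_nat.
  by rewrite invf_lt1 ?exprn_gt0 ?ltr0n ?prime_gt0 // exprn_egt1 // ltr1n prime_gt1.
have [l hl] := prod_cvg bK uK.
rewrite /prime_product (_ : (fun N => _) = (fun N => \prod_(0 <= n < N) (1 + u n))).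
  by rewrite (cvg_limC hl); exact: (prod_lim_neq0 bK uK u0 hl).
by apply/funext => N; exact: uE.
Qed.

Lemma prime_product_1B_neq0 (P : pred nat) :
  prime_product P (fun p => 1 - (p%:R ^+ 2)^-1) != 0 :> C.
Proof.
have c1 : cabs (- 1 : C) = 1 by rewrite cabsN cabs1.
have := prime_quadratic_product P c1.
by rewrite (@prime_product_ext _ _ (fun p => 1 - (p%:R ^+ 2)^-1)) // => p _ _; rewrite mulN1r.
Qed.

Lemma prime_product_1D_neq0 (P : pred nat) :
  prime_product P (fun p => 1 + (p%:R ^+ 2)^-1) != 0 :> C.
Proof.
have := prime_quadratic_product P (cabs1 R).
by rewrite (@prime_product_ext _ _ (fun p => 1 + (p%:R ^+ 2)^-1)) // => p _ _; rewrite mul1r.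
Qed.

(** The two sides agree factor by factor, once the products over the
    multiplicative primes are cancelled and [zeta(3)] is expanded. *)
Lemma B_reg2 : B_reg 2 =
  prime_product (bad E) (fun p : nat => (1 - p%:R^-1) * (1 - (p%:R ^+ 3)^-1)^-1)
   / (prime_product (split_mult E) (fun p : nat => 1 - (p%:R ^+ 2)^-1)
      * prime_product (nonsplit_mult E) (fun p : nat => 1 + (p%:R ^+ 2)^-1))
   * (ell_L E 2 / zeta 3).
Proof.
have hz : 2 - 32^-1 < complex.Re (2 : C) by rewrite (Re_nat 2); have := inv32_gt0; lra.
have h3 : 1 < complex.Re (3 : C) by rewrite (Re_nat 3); lra.
have z3 := zeta_neq0 h3.
have S0 := prime_product_1B_neq0 (split_mult E).
have N0 := prime_product_1D_neq0 (nonsplit_mult E).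
have P0 := P2_neq0 hz.
rewrite /ell_L.
rewrite (@prime_product_ext (split_mult E) (fun p => 1 - natpowC p (- 2))
  (fun p => 1 - (p%:R ^+ 2)^-1)); last first.
  by move=> p pp _; rewrite natpowCN_nat ?prime_gt0.
rewrite (@prime_product_ext (nonsplit_mult E) (fun p => 1 + natpowC p (- 2))
  (fun p => 1 + (p%:R ^+ 2)^-1)); last first.
  by move=> p pp _; rewrite natpowCN_nat ?prime_gt0.
have -> : prime_product (good E) (fun p => (1 - (frob_trace E p)%:~R * natpowC p (- 2) +
     natpowC p (1 - 2 * 2))^-1) = (P2 2)^-1.
  apply: prime_product_lim.
  rewrite (_ : (fun N => _) = (fun N => (\prod_(0 <= n < N) (1 + den_factor n 2))^-1)).
    by apply: cvgV => //; exact: cvg_P2.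
  apply/funext => N; rewrite -prodfV; apply: prod_mkfactor => p; rewrite /den_factor.
  by case: ifP => _; rewrite ?addrA // addr0 invr1.
have -> : prime_product (bad E) (fun p : nat => (1 - p%:R^-1) * (1 - (p%:R ^+ 3)^-1)^-1)
   = P1 2 * (zeta 3)^-1^-1.
  apply: prime_product_lim.
  rewrite (_ : (fun N => _) = (fun N => \prod_(0 <= n < N) (1 + num_factor n 2) *
    (\prod_(0 <= p < N | prime p) (1 - natpowC p (- 3)))^-1)).
    apply: cvgM; first exact: cvg_P1.
    by apply: cvgV; [rewrite invr_eq0 | exact: euler_product].
  apply/funext => N; rewrite [X in _ * X^-1]big_mkcond /= -prodfV -big_split /=.
  apply: prod_mkfactor => p; rewrite /num_factor.
  case pp: (prime p); cbv iota delta [andb]; last by rewrite addr0 invr1 mulr1.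
  have p0 := prime_gt0 pp.
  rewrite goodE natpowCN_nat //; case: (bad E p); cbv iota delta [negb].
    rewrite (_ : 1 - 2 = - 1%:R); last by ring.
    by rewrite natpowCN_nat // expr1.
  rewrite (_ : 1 - 2 * 2 = - 3%:R); last by ring.
  rewrite natpowCN_nat // divff //.
  rewrite -natpowCN_nat //; have := @one_sub_natpow_neq0 p 4 pp.
  rewrite (_ : 1 - 4 = - 3%:R); last by ring.
  by apply; rewrite (Re_nat 4); lra.
rewrite /B_reg zeta_reg2 mul1r invrK.
move: S0 N0 P0 z3.
move: (prime_product _ _) (prime_product _ _) (P1 2) (P2 2) (zeta 3) => a b c d e a0 b0 d0 e0.
by field; rewrite a0 b0 d0 e0.
Qed.

Lemma B_reg2_neq0 : B_reg 2 != 0.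
Proof.
have hz : 2 - 32^-1 < complex.Re (2 : C) by rewrite (Re_nat 2); have := inv32_gt0; lra.
rewrite /B_reg zeta_reg2 mul1r mulf_neq0 ?invr_neq0 //.
  exact: P1_neq0.
exact: P2_neq0.
Qed.

Lemma open_half_plane (c : R) : open (half_plane c).
Proof.
rewrite openE => z hz; rewrite /interior.
have e0 : 0 < (complex.Re z - c) / 2 by rewrite divr_gt0 // subr_gt0.
have /cvgCP /(_ _ e0) : (id : C -> C) @ z --> z by exact: cvg_id.
apply: filterS => s h; rewrite /half_plane /=.
have := le_trans (Re_le_cabs (z - s)) h; rewrite (_ : complex.Re (z - s) = complex.Re z - complex.Re s).
  by move=> /(le_trans (ler_norm _)); move: hz; rewrite /half_plane /= => hz h'; lra.
by case: (z) => a b; case: (s).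
Qed.

(** The half-plane is a union of segments with a common endpoint. *)
Lemma connected_half_plane (c : R) : connected (half_plane c).
Proof.
pose z0 : C := Complex (c + 1) 0.
have z0c : half_plane c z0 by rewrite /half_plane /=; lra.
pose path (w : C) (x : R) : C := z0 + Complex x 0 * (w - z0).
have pc w : continuous (path w).
  move=> x; apply/cvgCP => e e0.
  have d0 : 0 < e / (cabs (w - z0) + 1) by rewrite divr_gt0 // ltr_pwDr // cabs_ge0.
  have /cvgrPdist_le /(_ _ d0) : (id : R -> R) @ x --> x by exact: cvg_id.
  apply: filterS => y hy; rewrite /path.
  have cB : Complex (x - y) 0 = Complex x 0 - Complex y 0 :> C.
    by apply/eqP; rewrite eq_complex /= subr0 !eqxx.
  rewrite (_ : _ - _ = Complex (x - y) 0 * (w - z0)); last by rewrite cB; ring.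
  rewrite cabsM cabs_real; have c0 := cabs_ge0 (w - z0).
  rewrite ler_pdivlMr in hy; last by lra.
  by apply: le_trans hy; rewrite ler_wpM2l //; lra.
have -> : half_plane c = \bigcup_(w in half_plane c) (path w @` `[0, 1]).
  apply/seteqP; split=> [w hw|w [v hv [x /=]]].
    exists w => //; exists 1; first by rewrite /= in_itv /= ler01 lexx.
    by rewrite /path -[Complex 1 0]/(1 : C) mul1r addrC subrK.
  rewrite in_itv /= => /andP[x0 x1] <-; move: hv; rewrite /half_plane /path /z0 /=.
  case: v => a b /= ha.
  have ac : 0 <= x * (a - c) by rewrite mulr_ge0 // subr_ge0 ltW.
  by have [x1'|xx] := ltrP x 1; [lra | rewrite (_ : x = 1); [lra | apply/eqP; rewrite eq_le x1]].
apply: bigcup_connected.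
  exists z0 => w _; exists 0; first by rewrite /= in_itv /= ler01 lexx.
  by rewrite /path -[Complex 0 0]/(0 : C) mul0r addr0.
move=> w _; apply: connected_continuous_connected; first exact: segment_connected.
by apply: continuous_subspaceT; exact: pc.
Qed.

Lemma near_neq (z w : C) : z != w -> \forall s \near z, s != w.
Proof.
move=> zw; have e0 : 0 < cabs (z - w) / 2 by rewrite divr_gt0 // cabs_gt0 // subr_eq0.
have /cvgCP /(_ _ e0) : (id : C -> C) @ z --> z by exact: cvg_id.
by apply: filterS => s h; apply/eqP => sw; move: h; rewrite sw; lra.
Qed.

End Continuation.

Theorem mainTheorem4 (R : realType) (E : weierstrass rat)
    (hE : is_elliptic_curve E) :
  exists (U : set (Cplx R)) (B : Cplx R -> Cplx R),
    [/\ meromorphic_continuation (ell_B E) (half_plane 2) U B,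
        U 2 &
        simple_pole B 2
          (prime_product (bad E) (fun p : nat =>
             (1 - p%:R^-1) * (1 - (p%:R ^+ 3)^-1)^-1)
           / (prime_product (split_mult E) (fun p : nat =>
                1 - (p%:R ^+ 2)^-1)
              * prime_product (nonsplit_mult E) (fun p : nat =>
                1 + (p%:R ^+ 2)^-1))
           * (ell_L E 2 / zeta 3))].
Proof.
pose U := half_plane (2 - 32^-1 : R).
pose B (s : Cplx R) := B_reg E s / (s - 2).
have U2 : U 2.
  change (2 - 32^-1 < complex.Re (2 : Cplx R)).
  by rewrite (Re_nat R 2); have := inv32_gt0 R; lra.
have hol z : U z -> holomorphic_at (B_reg E) z.
  move=> Uz; rewrite /holomorphic_at.
  have : nbhs z U by apply: open_nbhs_nbhs; split; [exact: open_half_plane|].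
  by apply: filterS => s Us; exact: derivable_B_reg.
exists U, B; split=> //.
  split.
  - exact: open_half_plane.
  - exact: connected_half_plane.
  - by move=> s; rewrite /U /half_plane /=; have := inv32_gt0 R; lra.
  - by move=> s hs; rewrite ell_B_eq.
  move=> z Uz; have [->|z2] := eqVneq z 2.
    exists 1%N, (B_reg E); split; first exact: hol.
    by near=> s => _; rewrite expr1.
  exists 0%N, B; split; last by near=> s => _; rewrite expr0 divr1.
  have n1 := near_neq z2; have n2 := hol z Uz; rewrite /holomorphic_at in n2 *.
  apply: (@filterS2 _ _ (nbhs_filter z) _ _ _ _ n1 n2) => s s2 ds.
  have d2 : derivable (fun x : (Cplx R)^o => x - 2 : (Cplx R)^o) s 1.
    apply: (@derivableB _ (Cplx R)^o (Cplx R)^o (fun x => x) (fun=> 2)).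
      exact: derivable_id.
    exact: derivable_cst.
  have s20 : s - 2 != 0 by rewrite subr_eq0.
  exact: (derivableM ds (derivableV (f := fun x : (Cplx R)^o => x - 2) s20 d2)).
rewrite -B_reg2 //; split; first exact: B_reg2_neq0.
exists (B_reg E); split=> //; first exact: hol.
by near=> s.
Unshelve. all: by end_near.
Qed.
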